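(* Let $M$ be a Frobenius manifold with product $\cdot$, metric $\langle\ ,\ \rangle$, unity $e$ and Euler vector field $E$, and let $\Sigma\subset M$ be its discriminant. For $t\in M\setminus\Sigma$ and $u,v\in T_tM$ define a new multiplication $$u*v:=\frac{u\cdot v}{E}.$$ Then the multiplication $*$ together with the intersection form $(\ ,\ )$ of $M$, and with the vector field $E$ taken both as the unity and as the Euler vector field, satisfies on $M\setminus\Sigma$ all the axioms of a Frobenius manifold (FM1, FM2, FM3 of the context) except the requirement in FM1 that the unity vector field be flat.
   Context: A Frobenius algebra is a commutative associative algebra with unity and a symmetric nondegenerate bilinear form $\langle\ ,\ \rangle$ with $\langle x\cdot y,z\rangle=\langle x,y\cdot z\rangle$. A Frobenius manifold is a manifold $M$ with a Frobenius algebra structure on every tangent space $T_tM$ depending (smoothly, analytically etc.) on $t$ such that: (FM1) the metric $\langle\ ,\ \rangle$ is flat and, with $\nabla$ its Levi-Civita connection, the unity vector field $e$ is flat, $\nabla e=0$; (FM2) with $c(x,y,z)=\langle x\cdot y,z\rangle$, the 4-tensor $(\nabla_wc)(x,y,z)$ is symmetric in $x,y,z,w$; (FM3) a linear vector field $E$ (the Euler vector field) is fixed, i.e. $\nabla\nabla E=0$, such that $[E,x\cdot y]-[E,x]\cdot y-x\cdot[E,y]=x\cdot y$ and $E\langle x,y\rangle-\langle[E,x],y\rangle-\langle x,[E,y]\rangle=(2-d)\langle x,y\rangle$ for some constant $d$, called the charge. The product of 1-forms on $M$ is the one transported from $TM$ by the isomorphism $\langle\ ,\ \rangle:T_tM\to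 T_t^*M$. The intersection form is the symmetric bilinear form on $T^*M$ given by $(\omega_1,\omega_2)=i_E(\omega_1\cdot\omega_2)$. The discriminant $\Sigma$ is the set of points $t\in M$ where the intersection form on $T_t^*M$ is degenerate, equivalently where $E$ is not invertible in the algebra $T_tM$; it is a proper analytic subset. On $M\setminus\Sigma$ the inverse of the intersection form is a metric on the tangent spaces, again denoted $(\ ,\ )$, so that $(u,v)=\langle u,E^{-1}\cdot v\rangle$. Division by $E$ means multiplication by the inverse of $E$ with respect to $\cdot$.
   Formalization: For the new product, the FM3 identity is proved with right-hand side 0, i.e. [E,u*v]-[E,u]*v-u*[E,v]=0, instead of u*v: as E is the unity of *, putting u=v=E makes the left side vanish, so the identity with u*v cannot hold. *)

(* Defs.v *)
From HB Require Import structures.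
From mathcomp Require Import all_boot all_order all_algebra.
From mathcomp Require Import complex.
From mathcomp Require Import all_classical all_reals all_analysis.
Set Implicit Arguments.
Unset Strict Implicit.
Unset Printing Implicit Defensive.
Import Order.TTheory GRing.Theory Num.Theory numFieldNormedType.Exports.
Local Open Scope classical_set_scope.
Local Open Scope ring_scope.

(* Over R the notions below give smooth manifolds.  Over R[i] the derivatives
   are complex derivatives, and the same notions give complex-analytic
   manifolds with their holomorphic tensor fields. *)
Variant ground := RealGround | ComplexGround.

Definition scalars (R : realType) (g : ground) : numFieldType :=
  match g with RealGround => R | ComplexGround => R[i] end.

Section Pointwise.
Variables (K : numFieldType) (n : nat).
Local Notation V := 'rV[K]_n.
Implicit Types (m : V -> V -> V) (b : V -> V -> K) (u v w om : V).

Definition basis_vec (a : 'I_n) : V := delta_mx 0 a.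

Definition nondegenerate b := forall u, (forall v, b u v = 0) -> u = 0.

Definition frobenius_algebra m (e : V) b : Prop :=
  [/\ forall u, linear (m u), commutative m, associative m & left_id e m] /\
  [/\ forall u, scalar (b u), forall u v, b u v = b v u, nondegenerate b &
      forall u v w, b (m u v) w = b u (m v w)].

(* The multiplicative inverse is unique when it exists; otherwise this is an
   irrelevant default value. *)
Definition alg_inv m (e u : V) : V := xget 0 [set w | m u w = e].

Definition alg_div m (e u v : V) : V := m u (alg_inv m e v).

Definition gram b : 'M[K]_n := \matrix_(a, c) b (basis_vec a) (basis_vec c).

(* A covector is represented by the row of its values on the basis vectors. *)
Definition pairing om v : K := \sum_a om 0 a * v 0 a.

Definition flat_iso b u : V := \row_a b u (basis_vec a).

(* The inverse of [flat_iso] for a nondegenerate symmetric [b], for which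
   [flat_iso b u = u *m gram b]. *)
Definition sharp_iso b om : V := om *m invmx (gram b).

Definition comul m b om1 om2 : V :=
  flat_iso b (m (sharp_iso b om1) (sharp_iso b om2)).

Definition intersection_form m b (E : V) om1 om2 : K :=
  pairing (comul m b om1 om2) E.

(* The form on vectors whose Gram matrix is inverse to that of the
   intersection form on covectors. *)
Definition intersection_metric m b (E : V) u v : K :=
  (u *m invmx (gram (intersection_form m b E)) *m v^T) 0 0.

End Pointwise.

Section Calculus.
Variables (K : numFieldType) (n : nat).
Local Notation V := 'rV[K]_n.
Implicit Types (Om : set V) (f : V -> K) (X Y Z W : V -> V).
Implicit Types (mul : V -> V -> V -> V) (g : V -> V -> V -> K).

Definition pd (a : 'I_n) f : V -> K := fun x => 'D_(basis_vec K a) f x.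

Fixpoint Ck (k : nat) Om f : Prop :=
  (forall x, Om x -> {for x, continuous f}) /\
  match k with
  | 0 => True
  | k'.+1 => forall a, (forall x, Om x -> derivable f x (basis_vec K a)) /\
                       Ck k' Om (pd a f)
  end.

Definition smooth Om f := forall k, Ck k Om f.

Definition smooth_field Om X := forall a, smooth Om (fun x => X x 0 a).

Definition vf_apply X f : V -> K := fun x => \sum_a X x 0 a * pd a f x.

Definition bracket X Y : V -> V := fun x =>
  \row_k (vf_apply X (fun y => Y y 0 k) x - vf_apply Y (fun y => X y 0 k) x).

Definition mulf mul X Y : V -> V := fun x => mul x (X x) (Y x).

Definition metf g X Y : V -> K := fun x => g x (X x) (Y x).

Definition metric_comp g (a c : 'I_n) : V -> K :=
  fun x => gram (g x) a c.

Definition christoffel g (x : V) (a c k : 'I_n) : K :=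
  2^-1 * \sum_l invmx (gram (g x)) k l *
    (pd a (metric_comp g c l) x + pd c (metric_comp g a l) x
     - pd l (metric_comp g a c) x).

Definition nabla g X Y : V -> V := fun x =>
  \row_k (vf_apply X (fun y => Y y 0 k) x +
          \sum_a \sum_c christoffel g x a c k * X x 0 a * Y x 0 c).

(* The curvature vanishes.  Here and below the test fields are arbitrary fields
   on the chart domain, which need not extend to the whole manifold (over R[i]
   there may be too few global fields). *)
Definition flat_metric Om g : Prop :=
  forall X Y Z, smooth_field Om X -> smooth_field Om Y -> smooth_field Om Z ->
  forall x, Om x ->
    nabla g X (nabla g Y Z) x - nabla g Y (nabla g X Z) x
    - nabla g (bracket X Y) Z x = 0.

Definition parallel_field Om g Y : Prop :=
  forall X, smooth_field Om X -> forall x, Om x -> nabla g X Y x = 0.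

Definition linear_field Om g Y : Prop :=
  forall X Z, smooth_field Om X -> smooth_field Om Z ->
  forall x, Om x -> nabla g X (nabla g Z Y) x - nabla g (nabla g X Z) Y x = 0.

Definition c_tensor mul g X Y Z : V -> K := metf g (mulf mul X Y) Z.

Definition nabla_c mul g W X Y Z : V -> K := fun x =>
  vf_apply W (c_tensor mul g X Y Z) x
  - c_tensor mul g (nabla g W X) Y Z x
  - c_tensor mul g X (nabla g W Y) Z x
  - c_tensor mul g X Y (nabla g W Z) x.

(* The three adjacent transpositions generate all permutations. *)
Definition nabla_c_symmetric Om mul g : Prop :=
  forall W X Y Z, smooth_field Om W -> smooth_field Om X ->
    smooth_field Om Y -> smooth_field Om Z -> forall x, Om x ->
  [/\ nabla_c mul g W X Y Z x = nabla_c mul g X W Y Z x,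
      nabla_c mul g W X Y Z x = nabla_c mul g W Y X Z x &
      nabla_c mul g W X Y Z x = nabla_c mul g W X Z Y x].

(* [Lie_E mul = k mul] *)
Definition euler_mul Om mul E (k : K) : Prop :=
  forall X Y, smooth_field Om X -> smooth_field Om Y -> forall x, Om x ->
    bracket E (mulf mul X Y) x - mulf mul (bracket E X) Y x
    - mulf mul X (bracket E Y) x = k *: mulf mul X Y x.

Definition euler_metric Om g E (d : K) : Prop :=
  forall X Y, smooth_field Om X -> smooth_field Om Y -> forall x, Om x ->
    vf_apply E (metf g X Y) x - metf g (bracket E X) Y x
    - metf g X (bracket E Y) x = (2 - d) * metf g X Y x.

(* Components, in one coordinate chart, of the fields of a Frobenius
   structure; [fmul D x] and [fmetric D x] act on the tangent space at x. *)
Record frob_data := FrobData {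
  fmul : V -> V -> V -> V;
  fmetric : V -> V -> V -> K;
  funit : V -> V;
  feuler : V -> V }.

Implicit Type D : frob_data.

Definition smooth_data Om D : Prop :=
  [/\ forall a c k, smooth Om
        (fun x => fmul D x (basis_vec K a) (basis_vec K c) 0 k),
      forall a c, smooth Om
        (fun x => fmetric D x (basis_vec K a) (basis_vec K c)),
      smooth_field Om (funit D) & smooth_field Om (feuler D)].

(* All the conditions on a Frobenius manifold inside one chart except the
   flatness of the unity; [k] is the weight in [Lie_E mul = k mul]. *)
Definition local_frobenius Om (k d : K) D : Prop :=
  [/\ smooth_data Om D,
      forall x, Om x -> frobenius_algebra (fmul D x) (funit D x) (fmetric D x),
      flat_metric Om (fmetric D),
      nabla_c_symmetric Om (fmul D) (fmetric D) &
      [/\ linear_field Om (fmetric D) (feuler D),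
          euler_mul Om (fmul D) (feuler D) k &
          euler_metric Om (fmetric D) (feuler D) d]].

Definition dual_data D : frob_data := {|
  fmul := fun x u v => alg_div (fmul D x) (funit D x) (fmul D x u v) (feuler D x);
  fmetric := fun x => intersection_metric (fmul D x) (fmetric D x) (feuler D x);
  funit := feuler D;
  feuler := feuler D |}.

(* For the structure on the complement of the discriminant the weight has to be
   0, not 1: it is forced when the Euler field is also the unity: in
   [E, E.E] - [E, E].E - E.[E, E] = k E.E the left-hand side vanishes.  In
   particular k = 1 is impossible when E does not vanish. *)
Lemma euler_mul_unit Om (k d : K) D : open Om -> local_frobenius Om k d D ->
  funit D = feuler D -> forall x, Om x -> k *: feuler D x = 0.
Proof.
move=> Oo [[_ _ _ sE] FA _ _ [_ EM _]] ue x Ox.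
set E := feuler D in sE EM ue *.
have mEE y : Om y -> mulf (fmul D) E E y = E y.
  by move=> Oy; have [[_ _ _ unitl] _] := FA y Oy; rewrite /mulf -{1}ue unitl.
have nEE : \forall y \near x, mulf (fmul D) E E y = E y.
  by apply: filterS (open_nbhs_nbhs (conj Oo Ox)) => y /mEE.
have bEE : bracket E E x = 0 by apply/rowP => j; rewrite !mxE subrr.
have bE : bracket E (mulf (fmul D) E E) x = 0.
  rewrite -bEE; apply/rowP => j; rewrite !mxE; congr (_ - _).
    apply: eq_bigr => a _; congr (_ * _); apply: near_eq_derive.
    by apply: filterS nEE => y ->.
  by apply: eq_bigr => a _; rewrite mEE.
have [[lin comm _ _] _] := FA x Ox.
have m0 u : fmul D x u 0 = 0.
  by have /eqP := lin u 1 0 0; rewrite !scale1r addr0 -subr_eq subrr => /eqP.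
have := EM E E sE sE x Ox.
by rewrite bE {1 2}/mulf bEE m0 comm m0 !subrr mEE.
Qed.

End Calculus.

Record manifold (K : numFieldType) (n : nat) (M : topologicalType) := Manifold {
  chart_index : Type;
  chart_dom : chart_index -> set M;
  chart : chart_index -> M -> 'rV[K]_n;
  chart_inv : chart_index -> 'rV[K]_n -> M;
  manifold_hausdorff : hausdorff_space M;
  manifold_second_countable : @second_countable M;
  chart_cover : forall t, exists i, chart_dom i t;
  chart_dom_open : forall i, open (chart_dom i);
  chart_image_open : forall i, open (chart i @` chart_dom i);
  chartK : forall i t, chart_dom i t -> chart_inv i (chart i t) = t;
  chart_continuous : forall i t, chart_dom i t -> {for t, continuous (chart i)};
  chart_inv_continuous : forall i t, chart_dom i t ->
    {for chart i t, continuous (chart_inv i)};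
  chart_transition : forall i j a,
    smooth (chart i @` (chart_dom i `&` chart_dom j))
      (fun x => chart j (chart_inv i x) 0 a) }.

Section Global.
Variables (K : numFieldType) (n : nat) (M : topologicalType).
Variable A : manifold K n M.
Implicit Types (W : set M) (D : chart_index A -> frob_data K n).

(* Components v in the chart i become v *m jacobian i j t in the chart j. *)
Definition jacobian (i j : chart_index A) (t : M) : 'M[K]_n :=
  \matrix_(a, c) pd a (fun x => chart j (chart_inv i x) 0 c) (chart i t).

Definition tensorial W D : Prop :=
  forall i j t, W t -> chart_dom i t -> chart_dom j t ->
  let J := jacobian i j t in let x := chart i t in let y := chart j t in
  [/\ forall u v, fmul (D j) y (u *m J) (v *m J) = fmul (D i) x u v *m J,
      forall u v, fmetric (D j) y (u *m J) (v *m J) = fmetric (D i) x u v,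
      funit (D j) y = funit (D i) x *m J &
      feuler (D j) y = feuler (D i) x *m J].

Definition chart_image W (i : chart_index A) : set 'rV[K]_n :=
  chart i @` (chart_dom i `&` W).

(* The open submanifold W satisfies the axioms of a Frobenius manifold, except
   the flatness of the unity, with [Lie_E mul = k mul]. *)
Definition frobenius_except_flat_unity W (k : K) D : Prop :=
  [/\ open W, tensorial W D &
      exists d, forall i, local_frobenius (chart_image W i) k d (D i)].

Definition frobenius_manifold D : Prop :=
  frobenius_except_flat_unity setT 1 D /\
  forall i, parallel_field (chart_image setT i) (fmetric (D i)) (funit (D i)).

Definition discriminant D : set M :=
  [set t | exists2 i, chart_dom i t & let x := chart i t in
     ~ nondegenerate
         (intersection_form (fmul (D i) x) (fmetric (D i) x) (feuler (D i) x))].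

Definition almost_dual D : chart_index A -> frob_data K n :=
  fun i => dual_data (D i).

End Global.

(* Main.v *)
(* Write T = nabla E (a parallel endomorphism), F = E^-1, beta = (1 - d) / 2 and
   B = beta - T.  The Euler identities determine the derivative of the product m
   along E, (nabla_E m)(u, v) = uv + T(uv) - T(u)v - u T(v), and with (FM2) and
   associativity this gives
     nabla_u (F v) - F nabla_u v = F u T(F v) - F T(F u v) - F^2 u v.
   It follows that nabla*_u v = nabla_u v + B(F u v) is the Levi-Civita
   connection of (u, v) = <u, F v>: it is visibly torsion free, and metric by
   the formula above.  Since B is parallel, the same formula shows that nabla*
   is flat and that the nabla*-derivative along w of the product F u v is
   symmetric in w, u, v.  Also nabla* E = beta, so E stays linear, and the Lie
   derivatives of the dual product and metric along E have weights 0 and 1 - d.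

   The hypotheses give tensor identities by testing on constant fields; fields
   on the complement of the discriminant need not extend, so the vanishing of
   the curvature on them also requires the symmetry of mixed derivatives. *)
Require Import Defs.
From HB Require Import structures.
From mathcomp Require Import all_boot all_order all_algebra.
From mathcomp Require Import complex ring.
From mathcomp Require Import all_classical all_reals all_analysis.
Set Implicit Arguments.
Unset Strict Implicit.
Unset Printing Implicit Defensive.
Import Order.TTheory GRing.Theory Num.Theory numFieldNormedType.Exports.
Local Open Scope classical_set_scope.
Local Open Scope ring_scope.

(* Mathematical Components shadows these names. *)
Local Notation nondegenerate := Defs.nondegenerate.
Local Notation mulf := Defs.mulf.
Local Notation jacobian := Defs.jacobian.

(** * Smooth functions *)

Section SmoothFunctions.
Variables (K : numFieldType) (n : nat).
Local Notation V := 'rV[K]_n.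
Implicit Types (Om : set V) (f h : V -> K) (x : V).

Lemma open_eq_near Om f h x : open Om -> (forall y, Om y -> f y = h y) -> Om x ->
  {near x, f =1 h}.
Proof.
by move=> Oo fh Ox; apply: filterS (open_nbhs_nbhs (conj Oo Ox)) => y /fh.
Qed.

(** Openness turns agreement on [Om] into agreement near each of its points, so iterated derivatives
    agree as well. Derivative formulas valid only on [Om] can then be used in inductions on the
    order. *)
Lemma Ck_eq k Om f h : open Om -> (forall x, Om x -> f x = h x) ->
  Ck k Om f -> Ck k Om h.
Proof.
move=> Oo.
have ceq f' h' : (forall x, Om x -> f' x = h' x) ->
    (forall x, Om x -> {for x, continuous f'}) ->
    forall x, Om x -> {for x, continuous h'}.
  move=> fh cf x Ox; have : h' y @[y --> x] --> f' x.
    apply: cvg_trans (cf x Ox).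
    by apply: (@near_eq_cvg _ _ (nbhs x)); apply: open_eq_near Oo fh Ox.
  by rewrite fh.
elim: k f h => [|k IH] f h fh /= [cf df]; split=> //; try exact: ceq cf.
move=> a; have [daf Caf] := df a; split=> [x Ox|].
  by apply: near_eq_derivable (daf x Ox); apply: open_eq_near Oo fh Ox.
by apply: IH Caf => x Ox; apply: near_eq_derive; apply: open_eq_near Oo fh Ox.
Qed.

Lemma smooth_eq Om f h : open Om -> smooth Om f ->
  (forall x, Om x -> f x = h x) -> smooth Om h.
Proof. by move=> Oo sf fh k; apply: Ck_eq (sf k). Qed.

Lemma smooth_sub Om Om' f : Om' `<=` Om -> smooth Om f -> smooth Om' f.
Proof.
move=> sub sf k; elim: k f {sf}(sf k) => [|k IH] f /= [cf df].
  by split=> // x /sub /cf.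
split=> [x /sub /cf //|a]; have [daf Caf] := df a.
by split=> [x /sub /daf //|]; apply: IH.
Qed.

Lemma smooth_derivable Om f x a : smooth Om f -> Om x ->
  derivable f x (basis_vec K a).
Proof. by move=> /(_ 1%N) [_ /(_ a) [+ _]] Ox; apply. Qed.

Lemma smooth_pd Om f a : smooth Om f -> smooth Om (pd a f).
Proof. by move=> sf k; have [_ /(_ a) []] := sf k.+1. Qed.

Lemma smooth_continuous Om f x : smooth Om f -> Om x -> {for x, continuous f}.
Proof. by move=> /(_ 0%N) [+ _] Ox; apply. Qed.

Lemma Ck_prev k Om f : Ck k.+1 Om f -> Ck k Om f.
Proof.
elim: k f => [|k IH] f [cf df]; split=> // a.
by have [daf Caf] := df a; split=> //; apply: IH.
Qed.

Lemma smooth_cst Om (c : K) : smooth Om (fun=> c).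
Proof.
move=> k; elim: k c => [|k IH] c; split=> //; try by move=> x _; apply: cst_continuous.
move=> a; split=> [x _|]; first exact: derivable_cst.
have -> : pd a (fun=> c) = (fun=> 0 : K) by apply/funext => x; apply: derive_cst.
exact: IH.
Qed.

Lemma CkD k Om f h : open Om -> Ck k Om f -> Ck k Om h ->
  Ck k Om (fun x => f x + h x).
Proof.
move=> Oo; elim: k f h => [|k IH] f h /= [cf df] [ch dh].
  by split=> // x Ox; apply: continuousD; [apply: cf|apply: ch].
split=> [x Ox|a]; first by apply: continuousD; [apply: cf|apply: ch].
have [daf Caf] := df a; have [dah Cah] := dh a; split=> [x Ox|].
  by apply: derivableD; [apply: daf|apply: dah].
apply: Ck_eq (IH _ _ Caf Cah) => // x Ox.
by rewrite /pd [RHS]deriveD; [|apply: daf|apply: dah].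
Qed.

Lemma smoothD Om f h : open Om -> smooth Om f -> smooth Om h ->
  smooth Om (fun x => f x + h x).
Proof. by move=> Oo sf sh k; apply: CkD. Qed.

Lemma CkM k Om f h : open Om -> Ck k Om f -> Ck k Om h ->
  Ck k Om (fun x => f x * h x).
Proof.
move=> Oo; elim: k f h => [|k IH] f h Cf Ch.
  have [[cf _] [ch _]] := (Cf, Ch).
  by split=> // x Ox; apply: continuousM; [apply: cf|apply: ch].
have [[cf df] [ch dh]] := (Cf, Ch).
split=> [x Ox|a]; first by apply: continuousM; [apply: cf|apply: ch].
have [daf Caf] := df a; have [dah Cah] := dh a; split=> [x Ox|].
  by apply: derivableM; [apply: daf|apply: dah].
(* The product rule leaves [f] and [h] undifferentiated beside a derivative; they are needed there
   only at order [k]. *)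
apply: Ck_eq (CkD Oo (IH _ _ (Ck_prev Cf) Cah) (IH _ _ (Ck_prev Ch) Caf)) => //.
by move=> x Ox; rewrite /pd [RHS]deriveM; [|apply: daf|apply: dah].
Qed.

Lemma smoothM Om f h : open Om -> smooth Om f -> smooth Om h ->
  smooth Om (fun x => f x * h x).
Proof. by move=> Oo sf sh k; apply: CkM. Qed.

Lemma smoothN Om f : open Om -> smooth Om f -> smooth Om (fun x => - f x).
Proof.
move=> Oo sf; apply: (smooth_eq Oo (smoothM Oo (@smooth_cst _ (-1)) sf)) => x _.
by rewrite mulN1r.
Qed.

Lemma smoothB Om f h : open Om -> smooth Om f -> smooth Om h ->
  smooth Om (fun x => f x - h x).
Proof. by move=> Oo sf sh; apply: smoothD => //; apply: smoothN. Qed.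

Lemma smooth_sum Om I (r : seq I) (P : pred I) (F : I -> V -> K) : open Om ->
  (forall i, P i -> smooth Om (F i)) ->
  smooth Om (fun x => \sum_(i <- r | P i) F i x).
Proof.
move=> Oo sF; elim: r => [|i r IH].
  by apply: (smooth_eq Oo (@smooth_cst _ 0)) => x _; rewrite big_nil.
case: (boolP (P i)) => Pi.
  by apply: (smooth_eq Oo (smoothD Oo (sF i Pi) IH)) => x _; rewrite big_cons Pi.
by apply: (smooth_eq Oo IH) => x _; rewrite big_cons (negPf Pi).
Qed.

Lemma smooth_prod Om I (r : seq I) (P : pred I) (F : I -> V -> K) : open Om ->
  (forall i, P i -> smooth Om (F i)) ->
  smooth Om (fun x => \prod_(i <- r | P i) F i x).
Proof.
move=> Oo sF; elim: r => [|i r IH].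
  by apply: (smooth_eq Oo (@smooth_cst _ 1)) => x _; rewrite big_nil.
case: (boolP (P i)) => Pi.
  by apply: (smooth_eq Oo (smoothM Oo (sF i Pi) IH)) => x _; rewrite big_cons Pi.
by apply: (smooth_eq Oo IH) => x _; rewrite big_cons (negPf Pi).
Qed.

(** Induction on the order: the derivative -f' / f^2 involves 1 / f only at the previous order. *)
Lemma smoothV Om f : open Om -> (forall x, Om x -> f x != 0) ->
  smooth Om f -> smooth Om (fun x => (f x)^-1).
Proof.
move=> Oo f0 sf k; elim: k => [|k IH].
  by split=> // x Ox; apply: continuousV; [apply: f0|apply: smooth_continuous Ox].
split=> [x Ox|a].
  by apply: continuousV; [apply: f0|apply: smooth_continuous Ox].
split=> [x Ox|].
  by apply: derivableV; [apply: f0|apply: smooth_derivable Ox].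
have sN : smooth Om (fun x => - pd a f x) by apply: smoothN => //; apply: smooth_pd.
apply: Ck_eq (CkM Oo (sN k) (CkM Oo IH IH)) => // x Ox.
rewrite /pd [RHS]deriveV; [|exact: f0|exact: smooth_derivable Ox].
by rewrite /= -exprVn expr2 /GRing.scale /= mulrC mulrN mulNr.
Qed.

Lemma smooth_det Om m (A : V -> 'M[K]_m) : open Om ->
  (forall i j, smooth Om (fun x => A x i j)) -> smooth Om (fun x => \det (A x)).
Proof.
move=> Oo sA; apply: smooth_sum => // s _; apply: smoothM => //.
  exact: smooth_cst.
by apply: smooth_prod => // i _.
Qed.

(** Cramer's rule: each entry is a cofactor, polynomial in the entries of [A], divided by a
    determinant that does not vanish on [Om]. *)
Lemma smooth_invmx Om m (A : V -> 'M[K]_m) i j : open Om ->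
  (forall i j, smooth Om (fun x => A x i j)) ->
  (forall x, Om x -> A x \in unitmx) -> smooth Om (fun x => invmx (A x) i j).
Proof.
move=> Oo sA uA.
have sadj : smooth Om (fun x => (\adj (A x)) i j).
  have sc : smooth Om (fun x => cofactor (A x) j i).
    apply: smoothM => //; first exact: smooth_cst.
    apply: smooth_det => // i' j'.
    by apply: (smooth_eq Oo (sA (lift j i') (lift i j'))) => x _; rewrite !mxE.
  by apply: (smooth_eq Oo sc) => x _; rewrite mxE.
have sd : smooth Om (fun x => (\det (A x))^-1).
  apply: smoothV => //; last exact: smooth_det.
  by move=> x /uA; rewrite unitmxE unitfE.
apply: (smooth_eq Oo (smoothM Oo sd sadj)) => x Ox.
by rewrite /invmx uA // !mxE.
Qed.

End SmoothFunctions.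

(** * Symmetry of mixed partial derivatives *)

Section MixedPartials.
Variable R : realType.
Implicit Types (u us ut ust uts : R -> R -> R) (r h : R).

(** The mean value theorem is used twice: for s -> u s h - u s 0, and then for [us] along the
    vertical segment through the intermediate abscissa. *)
Lemma mixed_difference u us ust r h : 0 < h < r ->
  (forall s t, `|s| < r -> `|t| < r ->
     is_derive (s : R) 1 (u^~ t) (us s t) /\ is_derive (t : R) 1 (us s) (ust s t)) ->
  exists2 p : R * R, (0 < p.1 < h) && (0 < p.2 < h) &
    u h h - u h 0 - u 0 h + u 0 0 = ust p.1 p.2 * h * h.
Proof.
move=> /andP[h0 hr] du.
have itv_lt s : s \in `[0, h]%R -> `|s| < r.
  by rewrite in_itv /= => /andP[s0 sh]; rewrite ger0_norm //; apply: le_lt_trans hr.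
have itvoc s : s \in `]0, h[%R -> s \in `[0, h]%R.
  by rewrite !in_itv /= => /andP[/ltW -> /ltW ->].
have n0 : `|0 : R| < r by rewrite normr0; apply: lt_trans hr.
have nh : `|h| < r by rewrite gtr0_norm.
have dg s : `|s| < r ->
    is_derive (s : R) 1 (fun s => u s h - u s 0) (us s h - us s 0).
  move=> sr; have [d1 _] := du s h sr nh; have [d2 _] := du s 0 sr n0.
  exact: is_deriveB.
have [|xi xih Exi] := MVT h0 (fun s hs => dg s (itv_lt s (itvoc s hs))).
  apply: derivable_within_continuous => s hs.
  by have [] := dg s (itv_lt s hs).
have xir := itv_lt xi (itvoc xi xih).
have [|et eth Eet] := MVT h0 (fun t ht => (du xi t xir (itv_lt t (itvoc t ht))).2).
  apply: derivable_within_continuous => t ht.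
  by have [] := (du xi t xir (itv_lt t ht)).2.
exists (xi, et); first by move: xih eth; rewrite !in_itv /= => -> ->.
move: Exi; rewrite Eet !subr0 => <-.
by rewrite opprB addrA addrAC.
Qed.

(** The second difference over a square is the same in either order of the variables, so [ust] and
    [uts] share a value, taken at two points of the square. For a small square, continuity puts this
    value within e / 2 of both values at the origin. *)
Lemma mixed_partials u us ut ust uts r : 0 < r ->
  (forall s t, `|s| < r -> `|t| < r ->
     is_derive (s : R) 1 (u^~ t) (us s t) /\ is_derive (t : R) 1 (us s) (ust s t)) ->
  (forall s t, `|s| < r -> `|t| < r ->
     is_derive (t : R) 1 (u s) (ut s t) /\ is_derive (s : R) 1 (ut^~ t) (uts s t)) ->
  {for (0, 0), continuous (fun p => ust p.1 p.2)} ->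
  {for (0, 0), continuous (fun p => uts p.1 p.2)} ->
  ust 0 0 = uts 0 0.
Proof.
move=> r0 du1 du2 c1 c2; apply/eqP; rewrite -subr_eq0 -normr_le0.
apply/ler_addgt0Pr => e e0; rewrite add0r.
have e20 : 0 < e / 2 by rewrite divr_gt0.
have /cvgrPdist_lt /(_ _ e20) n1 := c1; have /cvgrPdist_lt /(_ _ e20) n2 := c2.
have [[B1 B2] [/= nB1 nB2] dB] := filterI n1 n2.
have nB : nbhs (0 : R) (B1 `&` B2) by apply: filterI.
have /nbhs_ballP[d /= d0 dP] := nB.
have [h [h0 hd hr]] : exists h : R, [/\ 0 < h, h < d & h < r].
  have m0 : 0 < Num.min d r by rewrite lt_min d0.
  exists (Num.min d r / 2); have m2 : Num.min d r / 2 < Num.min d r.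
    by rewrite ltr_pdivrMr // mulr2n mulrDr mulr1 ltrDl.
  by rewrite divr_gt0 //; split=> //; apply: lt_le_trans m2 _; rewrite ge_min lexx ?orbT.
have hh : 0 < h < r by rewrite h0.
have [[s t] /= /andP[/andP[s0 sh] /andP[t0 th]] E1] := mixed_difference hh du1.
have [[t' s'] /= /andP[/andP[t'0 t'h] /andP[s'0 s'h]] E2] :=
  @mixed_difference (fun t s => u s t) (fun t s => ut s t) (fun t s => uts s t)
    r h hh (fun t s ht hs => du2 s t hs ht).
have E : ust s t = uts s' t'.
  have hU : h * h != 0 by rewrite mulf_neq0 // gt_eqF.
  by apply: (mulIf hU); rewrite !mulrA; move: E1 E2 => /= <- <-; ring.
have inb v : 0 < v -> v < h -> (B1 `&` B2) v.
  move=> v0 vh; apply: dP; rewrite /ball /= sub0r normrN gtr0_norm //.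
  exact: lt_trans hd.
have [/= A _] := dB (s, t) (conj (inb _ s0 sh).1 (inb _ t0 th).2).
have [/= _ B] := dB (s', t') (conj (inb _ s'0 s'h).1 (inb _ t'0 t'h).2).
have -> : ust 0 0 - uts 0 0 = (ust 0 0 - ust s t) - (uts 0 0 - uts s' t').
  by rewrite E; ring.
apply: le_trans (ler_normB _ _) _; apply: ltW; rewrite (splitr e).
exact: ltrD.
Qed.

End MixedPartials.

(** * Reduction of mixed partials over the ground field to real slices *)

Section Schwarz.
Variables (R : realType) (K : numFieldType) (n : nat).
Variables (iota : {rmorphism R -> K}) (phi : K -> R).
Hypothesis iota_continuous : continuous iota.
Hypothesis phiB : forall w z, phi (w - z) = phi w - phi z.
Hypothesis phiZ : forall r z, phi (iota r * z) = r * phi z.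
Hypothesis phi_continuous : continuous phi.

(** The derivative over [K] is a limit over all small scalars; restricting it to the scalars
    [iota h] and applying [phi] gives a real derivative. The pair ([iota], [phi]) will be two
    identities, or the real embedding with the real or the imaginary part. *)
Lemma real_line_derive (f : 'rV[K]_n -> K) v (p : R -> 'rV[K]_n) s :
  (forall h, p (h + s) = iota h *: v + p s) -> derivable f (p s) v ->
  is_derive (s : R) 1 (fun s => phi (f (p s))) (phi ('D_v f (p s))).
Proof.
move=> pD df.
(* A field morphism is injective, so nonzero increments stay nonzero and punctured neighbourhoods
   are respected. *)
have c0 : iota h @[h --> 0^'] --> (0 : K)^'.
  move=> A nA; have := iota_continuous (x := 0); rewrite /continuous_at rmorph0.
  move=> /(_ _ nA); change (nbhs (0 : R) (fun h => iota h != 0 -> A (iota h)) ->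
    nbhs (0 : R) (fun h => h != 0 -> A (iota h))).
  by apply: filterS => h Ah h0; apply: Ah; rewrite fmorph_eq0.
pose F (s : R) : R := phi (f (p s)).
have cv : h^-1 *: ((F \o shift s) (h *: (1 : R)) - F s) @[h --> 0^']
    --> phi ('D_v f (p s)).
  have -> : (fun h : R => h^-1 *: ((F \o shift s) (h *: (1 : R)) - F s)) =
      phi \o ((fun h : K => h^-1 *: ((f \o shift (p s)) (h *: v) - f (p s))) \o iota).
    apply/funext => h /=.
    by rewrite -phiB /GRing.scale /= -phiZ fmorphV mulr1 pD.
  exact: (cvg_comp _ _ (cvg_comp _ _ c0 df) (phi_continuous (x := 'D_v f (p s)))).
apply: DeriveDef; last by apply: cvg_lim => //; exact: cv.
by apply/cvg_ex; exists (phi ('D_v f (p s))); exact: cv.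
Qed.

(** Restrict [phi \o f] to the real plane through [x] spanned by the two basis vectors and apply the
    real two-variable result at its origin. *)
Lemma schwarz (Om : set 'rV[K]_n) f x a b : open Om -> smooth Om f -> Om x ->
  phi (pd a (pd b f) x) = phi (pd b (pd a f) x).
Proof.
move=> Oo sf Ox.
pose ea := basis_vec K a; pose eb := basis_vec K b.
pose p s t : 'rV[K]_n := x + iota s *: eb + iota t *: ea.
have pc : {for ((0 : R), (0 : R)), continuous (fun q => p q.1 q.2)}.
  apply: continuousD; last first.
    apply: continuousZr_tmp; apply: continuous_comp; first exact: cvg_snd.
    exact: iota_continuous.
  apply: continuousD; first exact: cvg_cst.
  apply: continuousZr_tmp; apply: continuous_comp; first exact: cvg_fst.
  exact: iota_continuous.
have p00 : p 0 0 = x by rewrite /p rmorph0 !scale0r !addr0.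
have [r r0 rP] : exists2 r : R, 0 < r &
    forall s t, `|s| < r -> `|t| < r -> Om (p s t).
  have := pc Om; rewrite /= p00 => /(_ (open_nbhs_nbhs (conj Oo Ox))).
  move=> [[B1 B2] [/= nB1 nB2] dB].
  have nB : nbhs (0 : R) (B1 `&` B2) by apply: filterI.
  have /nbhs_ballP[d /= d0 dP] := nB; exists d => // s t sd td.
  apply: (dB (s, t)); split; [apply: (dP s _).1|apply: (dP t _).2];
    by rewrite /ball /= sub0r normrN.
have pS s t h : p (h + s) t = iota h *: eb + p s t.
  by rewrite /p rmorphD scalerDl addrCA -!addrA.
have pT s t h : p s (h + t) = iota h *: ea + p s t.
  by rewrite /p rmorphD scalerDl addrCA.
have cont h : smooth Om h -> {for ((0 : R), (0 : R)), continuous (fun q => phi (h (p q.1 q.2)))}.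
  move=> sh; apply: (continuous_comp (f := fun q : R * R => h (p q.1 q.2))).
    apply: (continuous_comp (f := fun q : R * R => p q.1 q.2)) => //=.
    by rewrite p00; apply: smooth_continuous sh Ox.
  exact: phi_continuous.
rewrite -p00.
apply: (@mixed_partials R (fun s t => phi (f (p s t)))
   (fun s t => phi (pd b f (p s t))) (fun s t => phi (pd a f (p s t)))
   (fun s t => phi (pd a (pd b f) (p s t))) (fun s t => phi (pd b (pd a f) (p s t))) r r0).
- move=> s t sr tr; split.
    apply: (@real_line_derive f eb (fun s => p s t)) => //.
    exact: smooth_derivable sf (rP _ _ sr tr).
  apply: (@real_line_derive (pd b f) ea (p s)) => //.
  exact: smooth_derivable (smooth_pd b sf) (rP _ _ sr tr).
- move=> s t sr tr; split.
    apply: (@real_line_derive f ea (p s)) => //.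
    exact: smooth_derivable sf (rP _ _ sr tr).
  apply: (@real_line_derive (pd a f) eb (fun s => p s t)) => //.
  exact: smooth_derivable (smooth_pd a sf) (rP _ _ sr tr).
- by apply: cont; do 2!apply: smooth_pd.
- by apply: cont; do 2!apply: smooth_pd.
Qed.
End Schwarz.

(** Here [j] carries real radii into [K]; additivity moves the bound at 0 to every point. *)
Lemma bounded_additive_continuous (R : realType) (K : numFieldType)
    (j : R -> K) (phi : K -> R) :
  (forall e, 0 < e -> 0 < j e) -> (forall w z, phi (w - z) = phi w - phi z) ->
  (forall z e, `|z| < j e -> `|phi z| < e) -> continuous phi.
Proof.
move=> j0 phiB phij z; apply/(@cvgrPdist_lt _ _ _ (nbhs z)) => e /j0 e0.
have /(@cvgrPdist_lt _ _ _ (nbhs z)) /(_ _ e0) : id w @[w --> z] --> z by apply: cvg_id.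
by apply: (@filterS _ (nbhs z)) => w h; rewrite -phiB; apply: phij.
Qed.

Section ComplexContinuity.
Variable R : realType.
Local Notation C := (scalars R ComplexGround).

Lemma real_complex_continuous : continuous (real_complex R : R -> C).
Proof.
move=> x; apply/cvgrPdist_lt => e e0.
(* A positive complex number has zero imaginary part, so the given radius is real. *)
have [d d0 ->] : exists2 d : R, 0 < d & e = real_complex R d.
  move: e0; case: e => a b; rewrite ltcE /= => /andP[/eqP -> a0].
  by exists a.
have idc : {for x, continuous (id : R -> R)} by apply: cvg_id.
have /cvgrPdist_lt /(_ d d0) := idc.
apply: filterS => y xy.
have nE (z : R) : `|real_complex R z : C| = real_complex R `|z|.
  by rewrite normc_def /= expr0n addr0 sqrtr_sqr.
by rewrite -(rmorphB (real_complex R)) nE ltcR.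
Qed.

Lemma Re_continuous : continuous (@complex.Re R : C -> R).
Proof.
apply: (@bounded_additive_continuous _ R[i] (real_complex R)).
- by move=> e; rewrite ltcR.
- by move=> w z; rewrite raddfB.
- by move=> z e /(le_lt_trans (normc_ge_Re z)); rewrite ltcR.
Qed.

Lemma Im_continuous : continuous (@complex.Im R : C -> R).
Proof.
apply: (@bounded_additive_continuous _ R[i] (real_complex R)).
- by move=> e; rewrite ltcR.
- by move=> w z; rewrite raddfB.
- case=> a b e; have le_Im : real_complex R `|b| <= `|(a +i* b)%C|.
    rewrite normc_def lecR /= -sqrtr_sqr.
    by rewrite ler_sqrt ?lerDr ?sqr_ge0 ?addr_ge0 ?sqr_ge0.
  by move=> /(le_lt_trans le_Im); rewrite ltcR.
Qed.

End ComplexContinuity.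

(** Over the reals both maps are identities; over the complex numbers the real and imaginary parts
    are treated separately and together determine the value. *)
Lemma pd_comm (R : realType) (g : ground) n (Om : set 'rV[scalars R g]_n) f x a b :
  open Om -> smooth Om f -> Om x -> pd a (pd b f) x = pd b (pd a f) x.
Proof.
case: g Om f x => /= Om f x Oo sf Ox.
  apply: (@schwarz R R n idfun idfun _ _ _ _ Om f x a b Oo sf Ox) => //.
  - by move=> y; apply: cvg_id.
  - by move=> y; apply: cvg_id.
have ReZ (r : R) (z : R[i]) : complex.Re (real_complex R r * z) = r * complex.Re z.
  by case: z => c d /=; rewrite mul0r subr0.
have ImZ (r : R) (z : R[i]) : complex.Im (real_complex R r * z) = r * complex.Im z.
  by case: z => c d /=; rewrite mul0r addr0.
have Ere := @schwarz R R[i] n (real_complex R) (@complex.Re R)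
  (@real_complex_continuous R) (raddfB _) ReZ (@Re_continuous R) Om f x a b Oo sf Ox.
have Eim := @schwarz R R[i] n (real_complex R) (@complex.Im R)
  (@real_complex_continuous R) (raddfB _) ImZ (@Im_continuous R) Om f x a b Oo sf Ox.
have complex_ext (z w : R[i]) : complex.Re z = complex.Re w ->
    complex.Im z = complex.Im w -> z = w.
  by case: z w => c d [c' d'] /= -> ->.
exact: complex_ext Ere Eim.
Qed.

(** * The pointwise identities of almost duality *)

Section DualAlgebra.
(** [A] stands for one tangent algebra, [N w u v] for (nabla_w m)(u, v), [T] for nabla E, [F] for
    the inverse of E, [dF u] for nabla_u F, and [b] for beta times the unity. The hypotheses are the
    differentiated axioms at the point, so the geometry reduces to ring identities. *)
Variables (A : comPzRingType) (N : A -> A -> A -> A) (T dF : A -> A) (E F b : A).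
Hypothesis EF : E * F = 1.
Hypothesis N_sym : forall w u v, N w u v = N u w v.
Hypothesis N_comm : forall w u v, N w u v = N w v u.
Hypothesis N_assoc : forall w u v z,
  N w (u * v) z + N w u v * z = N w u (v * z) + u * N w v z.
Hypothesis N_one : forall w u, N w 1 u = 0.
Hypothesis N_euler : forall u v, N E u v = u * v + T (u * v) - T u * v - u * T v.
Hypothesis dF_eq : forall u, N u E F + T u * F + E * dF u = 0.

Definition shift_op (q : A) := b * q - T q.
Local Notation B := shift_op.

(* The covariant derivative of [v |-> F * v]. *)
Definition deriv_inv (u v : A) := N u F v + dF u * v.
Local Notation G := deriv_inv.

(** Both [N u F v] and [dF u] are expressed through [N u E], which symmetry and the Euler identity
    make explicit; the terms in [N u E F] cancel. *)
Lemma deriv_invE u v :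
  G u v = F * u * T (F * v) - F * T (F * u * v) - F * F * u * v.
Proof.
have vE : v = E * (F * v) by rewrite mulrA EF mul1r.
have NE w q : N w E q = w * q + T (w * q) - T w * q - w * T q by rewrite N_sym N_euler.
(* Differentiated associativity on the triple F, E, F v; its first term vanishes because F E = 1. *)
have NF : N u F v = N u E F * (F * v) - F * N u E (F * v).
  have := N_assoc u F E (F * v).
  by rewrite (mulrC F E) EF N_one add0r -vE (N_comm u F E) => ->; ring.
(* The derivative of E F = 1, solved for [dF u]. *)
have dFE : dF u = - (F * (N u E F + T u * F)).
  have -> : dF u = F * (N u E F + T u * F + E * dF u) - F * (N u E F + T u * F).
    by rewrite mulrDr (mulrA F E) (mulrC F E) EF; ring.
  by rewrite dF_eq; ring.
rewrite /G NF dFE !NE (_ : u * (F * v) = F * u * v); ring.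
Qed.

(** The curvature of the dual connection will be that of nabla plus [B] of this expression. By the
    formula for [G], its terms either are symmetric in [x] and [y] or cancel against the [T] part of
    [B]. *)
Lemma dual_curvature_eq0 x y z :
  G x (y * z) - G y (x * z) + F * (x * B (F * (y * z))) - F * (y * B (F * (x * z))) = 0.
Proof.
rewrite !deriv_invE /B !mulrA (_ : F * y * x = F * x * y); ring.
Qed.

(** The two sides are dual covariant derivatives of the dual product. The term F w T(F x y) of
    [G w (x * y)] is exchanged with the [T] part of the last summand; everything else is visibly
    symmetric. *)
Lemma dual_product_sym w x y :
  G w (x * y) + F * N w x y + B (F * (w * (F * (x * y))))
   - F * (B (F * (w * x)) * y) - F * (x * B (F * (w * y))) =
  G x (w * y) + F * N x w y + B (F * (x * (F * (w * y))))
   - F * (B (F * (x * w)) * y) - F * (w * B (F * (x * y))).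
Proof.
rewrite !deriv_invE (N_sym x w) /B !mulrA.
rewrite (_ : F * w * F * x * y = F * x * F * w * y) //; last by ring.
rewrite (_ : F * w * x = F * x * w) //; last by ring.
ring.
Qed.

(** The Lie derivative of the dual product along E in covariant form. The term -F^2 u v of [G], at u
    = E, cancels the weight 1 of the original product. *)
Lemma dual_euler_mul x y :
  G E (x * y) + F * N E x y - T (F * (x * y)) + F * (T x * y) + F * (x * T y) = 0.
Proof.
rewrite deriv_invE N_euler (_ : F * E * (x * y) = x * y).
  by ring: EF.
by ring: EF.
Qed.

Section Form.
Variables (K : comPzRingType) (bf : A -> A -> K) (c beta : K).
Hypothesis bfD : forall u v w, bf u (v + w) = bf u v + bf u w.
Hypothesis bfN : forall u v, bf u (- v) = - bf u v.
Hypothesis bf_sym : forall u v, bf u v = bf v u.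
Hypothesis bf_frob : forall u v w, bf (u * v) w = bf u (v * w).
Hypothesis bf_T : forall u v, bf (T u) v + bf u (T v) = c * bf u v.
Hypothesis bf_b : forall u v, bf u (b * v) = beta * bf u v.
Hypothesis cE : c = beta + beta + 1.

(** With [bf] the metric and c = 2 - d, [bf_T] says that the adjoint of [T] is c - [T]. Moving [T]
    across the form leaves multiples of bf(F u v, F w), which balance because c - 1 = 2 beta. *)
Lemma dual_compat u v w :
  bf v (G u w) = bf (B (F * (u * v))) (F * w) + bf v (F * B (F * (u * w))).
Proof.
have swap p q r : bf p (q * r) = bf (p * q) r by rewrite bf_frob.
rewrite deriv_invE /B (bf_sym (_ - _)) mulrBr !bfD !bfN.
have E1 : bf v (F * u * T (F * w)) = bf (F * (u * v)) (T (F * w)).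
  by rewrite swap; congr bf; ring.
have E2 : bf (F * w) (b * (F * (u * v))) = beta * bf (F * (u * v)) (F * w).
  by rewrite bf_b bf_sym.
have E3 : bf v (F * F * u * w) = bf (F * (u * v)) (F * w).
  rewrite (_ : F * F * u * w = F * u * (F * w)); last by ring.
  by rewrite swap; congr bf; ring.
have E4 : bf v (F * (b * (F * (u * w)))) = beta * bf (F * (u * v)) (F * w).
  rewrite (_ : F * (b * _) = b * (F * F * u * w)) ?bf_b ?E3 //; last by ring.
rewrite E1 E2 E3 E4 (bf_sym (F * w)) (mulrA F u w).
have := bf_T (F * (u * v)) (F * w); rewrite cE.
move: (bf (T _) _) (bf _ (T (F * w))) => p q pq.
have -> : q = (beta + beta + 1) * bf (F * (u * v)) (F * w) - p by rewrite -pq; ring.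
ring.
Qed.

(** The Lie derivative of the dual metric along E. At u = E the term -F^2 u v of [G] becomes -F w
    and lowers the weight from c to c - 1. *)
Lemma dual_euler_form v w :
  bf v (G E w) + bf (T v) (F * w) + bf v (F * T w) = (c - 1) * bf v (F * w).
Proof.
have -> : G E w = T (F * w) - F * T w - F * w.
  rewrite deriv_invE (_ : F * E * w = w); ring: EF.
rewrite !bfD !bfN mulrBl -bf_T; ring.
Qed.

End Form.
End DualAlgebra.

(** * Frobenius algebras in coordinates *)


Section LinearForms.
Variables (K : numFieldType) (n : nat).
Local Notation V := 'rV[K]_n.

Lemma linear_fun0 (U W : lmodType K) (f : U -> W) : linear f -> f 0 = 0.
Proof. by move=> /(_ 1 0 0) /eqP; rewrite !scale1r addr0 -subr_eq subrr => /eqP. Qed.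

Lemma linear_funD (U W : lmodType K) (f : U -> W) : linear f ->
  forall u v, f (u + v) = f u + f v.
Proof. by move=> lf u v; have := lf 1 u v; rewrite !scale1r. Qed.

Lemma linear_funZ (U W : lmodType K) (f : U -> W) : linear f ->
  forall k u, f (k *: u) = k *: f u.
Proof. by move=> lf k u; rewrite -[k *: u]addr0 lf linear_fun0 ?addr0. Qed.

Lemma linear_funN (U W : lmodType K) (f : U -> W) : linear f ->
  forall u, f (- u) = - f u.
Proof. by move=> lf u; rewrite -scaleN1r linear_funZ // scaleN1r. Qed.

Lemma linear_fun_expand (W : lmodType K) (f : V -> W) v : linear f ->
  f v = \sum_c v 0 c *: f (basis_vec K c).
Proof.
move=> lf; rewrite [in LHS](row_sum_delta v).
rewrite (big_morph f (linear_funD lf) (linear_fun0 lf)).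
by apply: eq_bigr => c _; rewrite (linear_funZ lf).
Qed.

Lemma scalar_fun_expand (f : V -> K) v : scalar f ->
  f v = \sum_c v 0 c * f (basis_vec K c).
Proof. exact: (@linear_fun_expand K^o). Qed.

Lemma gramE (b : V -> V -> K) u v : (forall u, scalar (b u)) ->
  (forall v, scalar (b^~ v)) -> b u v = (u *m gram b *m v^T) 0 0.
Proof.
move=> lr ll; rewrite (scalar_fun_expand v (lr u)) mxE; apply: eq_bigr => c _.
rewrite !mxE mulrC; congr (_ * _); rewrite (scalar_fun_expand u (ll _)).
by apply: eq_bigr => a _; rewrite mxE.
Qed.

Lemma gram_unitmx (b : V -> V -> K) : (forall u, scalar (b u)) ->
  (forall v, scalar (b^~ v)) -> nondegenerate b -> gram b \in unitmx.
Proof.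
move=> lr ll nd; rewrite -row_free_unit; apply: inj_row_free => u uG.
by apply: nd => v; rewrite gramE // uG mul0mx mxE.
Qed.

End LinearForms.

(** * One Frobenius algebra: invertibility of the Euler vector and the intersection metric *)

Section FrobeniusAlgebra.
Variables (K : numFieldType) (n : nat).
Local Notation V := 'rV[K]_n.
Variables (m : V -> V -> V) (e : V) (b : V -> V -> K).
Hypothesis frob : frobenius_algebra m e b.

Lemma frob_linr u : linear (m u). Proof. by case: frob => -[]. Qed.
Lemma frob_mulC : commutative m. Proof. by case: frob => -[]. Qed.
Lemma frob_mulA : associative m. Proof. by case: frob => -[]. Qed.
Lemma frob_mul1 : left_id e m. Proof. by case: frob => -[]. Qed.
Lemma frob_linl v : linear (m^~ v).
Proof. by move=> a x y; rewrite !(frob_mulC _ v) frob_linr. Qed.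
Lemma frob_mulDl : left_distributive m +%R.
Proof. by move=> x y z; apply: linear_funD (frob_linl z) x y. Qed.
Lemma form_linr u : scalar (b u). Proof. by case: frob => _ []. Qed.
Lemma form_sym u v : b u v = b v u. Proof. by case: frob => _ []. Qed.
Lemma form_linl v : scalar (b^~ v).
Proof. by move=> a x y; rewrite !(form_sym _ v) form_linr. Qed.
Lemma form_nondeg : nondegenerate b. Proof. by case: frob => _ []. Qed.
Lemma form_frob u v w : b (m u v) w = b u (m v w). Proof. by case: frob => _ []. Qed.

(** The row vectors keep their addition and receive [m] as product, so ring identities about
    [frob_ring] convert to statements about [m]. *)
Definition frob_ring : comPzRingType :=
  HB.pack V (GRing.Zmodule_isComPzRing.Build V frob_mulA frob_mulC frob_mul1 frob_mulDl).

Lemma frob_gram_unitmx : gram b \in unitmx.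
Proof. exact: gram_unitmx form_linr form_linl form_nondeg. Qed.

Lemma flat_isoE u : flat_iso b u = u *m gram b.
Proof.
apply/rowP => a; rewrite !mxE (scalar_fun_expand u (form_linl _)).
by apply: eq_bigr => c _; rewrite mxE.
Qed.

Lemma flat_isoK : cancel (flat_iso b) (sharp_iso b).
Proof. by move=> u; rewrite flat_isoE /sharp_iso mulmxK // frob_gram_unitmx. Qed.

Lemma sharp_isoK : cancel (sharp_iso b) (flat_iso b).
Proof. by move=> u; rewrite flat_isoE /sharp_iso mulmxKV // frob_gram_unitmx. Qed.

Lemma pairing_flat u v : pairing (flat_iso b u) v = b u v.
Proof.
rewrite (scalar_fun_expand v (form_linr u)); apply: eq_bigr => a _.
by rewrite mxE mulrC.
Qed.

Variable E : V.

Lemma intersection_formE om1 om2 : intersection_form m b E om1 om2 =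
  b (m E (sharp_iso b om1)) (sharp_iso b om2).
Proof.
by rewrite /intersection_form /comul pairing_flat form_sym -form_frob.
Qed.

Lemma sharp_linear : linear (sharp_iso b).
Proof. by move=> a x y; rewrite /sharp_iso mulmxDl scalemxAl. Qed.

Lemma intersection_form_linr om : scalar (intersection_form m b E om).
Proof. by move=> a x y; rewrite !intersection_formE sharp_linear form_linr. Qed.

Lemma intersection_form_linl om : scalar (intersection_form m b E ^~ om).
Proof.
by move=> a x y; rewrite !intersection_formE sharp_linear frob_linr form_linl.
Qed.

Lemma intersection_nondeg F : m E F = e -> nondegenerate (intersection_form m b E).
Proof.
move=> EF om om0.
have : m E (sharp_iso b om) = 0.
  apply: form_nondeg => v; rewrite -(flat_isoK v) -intersection_formE; exact: om0.
move=> /(congr1 (m F)); rewrite (linear_fun0 (frob_linr F)) frob_mulA (frob_mulC F) EF.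
rewrite frob_mul1 => /(congr1 (flat_iso b)); rewrite sharp_isoK => ->.
by rewrite flat_isoE mul0mx.
Qed.

(** Multiplication by [E] as a matrix acting on rows: its determinant detects invertibility, and its
    inverse gives a smooth formula for the inverse of [E]. *)
Definition mulmatrix : 'M[K]_n := \matrix_(a, k) m E (basis_vec K a) 0 k.

Lemma mulmatrixE u : m E u = u *m mulmatrix.
Proof.
rewrite (linear_fun_expand u (frob_linr E)); apply/rowP => k; rewrite summxE mxE.
by apply: eq_bigr => a _; rewrite !mxE.
Qed.

Lemma mulmatrix_inv F : m E F = e -> mulmatrix \in unitmx.
Proof.
move=> EF; rewrite -row_free_unit; apply: inj_row_free => u; rewrite -mulmatrixE.
move=> /(congr1 (m F)); rewrite (linear_fun0 (frob_linr F)) frob_mulA (frob_mulC F) EF.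
by rewrite frob_mul1.
Qed.

Lemma mulmatrix_unit_inv : mulmatrix \in unitmx -> m E (e *m invmx mulmatrix) = e.
Proof. by move=> u; rewrite mulmatrixE mulmxKV. Qed.

(** If E u = 0, the covector of [u] lies in the kernel of the form, so multiplication by [E] is
    injective, hence bijective in finite dimension. The inverse is the preimage of [e]. *)
Lemma nondeg_invertible : nondegenerate (intersection_form m b E) ->
  exists F, m E F = e.
Proof.
move=> nd; exists (e *m invmx mulmatrix); apply: mulmatrix_unit_inv.
rewrite -row_free_unit; apply: inj_row_free => u; rewrite -mulmatrixE => Eu.
rewrite -(flat_isoK u) (nd (flat_iso b u)) ?(linear_fun0 sharp_linear) // => v.
by rewrite intersection_formE flat_isoK Eu form_sym (linear_fun0 (form_linr _)).
Qed.

Lemma alg_inv_unique F : m E F = e -> alg_inv m e E = F.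
Proof.
move=> EF; have EI : m E (alg_inv m e E) = e.
  by rewrite /alg_inv; case: xgetP => [w _ //|/(_ F)].
set I := alg_inv m e E in EI *.
by rewrite -(frob_mul1 I) -EF (frob_mulC E) -frob_mulA EI frob_mulC frob_mul1.
Qed.

(** The Gram matrix need not be inverted explicitly: it sends the covector of F u to [u], since
    pairing that covector under the form multiplies by E. *)
Lemma intersection_metricE F u v : m E F = e ->
  intersection_metric m b E u v = b u (m F v).
Proof.
move=> EF; rewrite /intersection_metric.
set A := gram _; have uA : A \in unitmx.
  apply: gram_unitmx; [exact: intersection_form_linr|exact: intersection_form_linl|].
  exact: intersection_nondeg EF.
have -> : u *m invmx A = flat_iso b (m F u).
  apply: (canLR (mulmxK uA)); apply/rowP => c.
  have -> : (flat_iso b (m F u) *m A) 0 c =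
      intersection_form m b E (flat_iso b (m F u)) (basis_vec K c).
    rewrite (gramE _ _ intersection_form_linr intersection_form_linl).
    by rewrite /basis_vec trmx_delta -colE [RHS]mxE.
  rewrite intersection_formE flat_isoK frob_mulA EF frob_mul1 form_sym.
  rewrite -pairing_flat sharp_isoK /pairing (bigD1 c) //= big1 => [|a ac].
    by rewrite mxE !eqxx mul1r addr0.
  by rewrite mxE (negPf ac) andbF mul0r.
by rewrite -form_frob (frob_mulC u) -pairing_flat /pairing mxE; apply: eq_bigr => a _; rewrite !mxE.
Qed.

Lemma dual_frobenius_algebra F : m E F = e ->
  frobenius_algebra (fun u v => alg_div m e (m u v) E) E (intersection_metric m b E).
Proof.
move=> EF; have FE u : m F (m E u) = u by rewrite frob_mulA (frob_mulC F) EF frob_mul1.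
have dE u v : alg_div m e (m u v) E = m F (m u v).
  by rewrite /alg_div (alg_inv_unique EF) frob_mulC.
have bE u v : intersection_metric m b E u v = b u (m F v) by apply: intersection_metricE.
split; split.
- by move=> u a x y; rewrite !dE !frob_linr.
- by move=> x y; rewrite !dE (frob_mulC x).
- move=> x y z; rewrite !dE.
  have assocF (f p q r : frob_ring) : f * (p * (f * (q * r))) = f * (f * (p * q) * r) by ring.
  exact: assocF.
- by move=> x; rewrite dE FE.
- by move=> u a x y; rewrite !bE frob_linr form_linr.
- by move=> u v; rewrite !bE [RHS]form_sym (frob_mulC F u) form_frob.
- move=> u u0; have : m F u = 0.
    by apply: form_nondeg => v; rewrite frob_mulC form_frob -bE.
  move=> /(congr1 (m E)); rewrite frob_mulA EF frob_mul1 => ->.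
  exact: linear_fun0 (frob_linr _).
- move=> u v w; rewrite !dE !bE.
  have ringE (f p q r : frob_ring) : f * (p * q) = p * (f * q) /\
    (f * q) * (f * r) = f * (f * (q * r)) by split; ring.
  have [/= E1 E2] := ringE F u v w.
  by rewrite (E1 : m F (m u v) = m u (m F v)) form_frob; congr (b u _); exact: E2.
Qed.

End FrobeniusAlgebra.

(** * Derivatives of fields and bundle maps *)

Section Derivations.
Variables (K : numFieldType) (n : nat) (Om : set 'rV[K]_n).
Hypothesis Oo : open Om.
Local Notation V := 'rV[K]_n.
Implicit Types (f h : V -> K) (X Y Z : V -> V) (u v w x : V).

(** Point and direction are separate arguments, which makes linearity in [u] expressible at a fixed
    point; [vf_apply X f x] unfolds to [dd x (X x) f]. *)
Definition dd x u f : K := \sum_a u 0 a * pd a f x.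
Definition ddv x u Y : V := \row_k dd x u (fun y => Y y 0 k).

Lemma dd_eq f h x u : Om x -> (forall y, Om y -> f y = h y) -> dd x u f = dd x u h.
Proof.
move=> Ox fh; apply: eq_bigr => a _; congr (_ * _); apply: near_eq_derive.
exact: open_eq_near Oo fh Ox.
Qed.

Lemma dd_scalar x f : scalar (fun u => dd x u f).
Proof.
move=> k u v; rewrite /dd mulr_sumr -big_split; apply: eq_bigr => a _.
by rewrite !mxE mulrDl mulrA.
Qed.

Lemma dd_cst x u (c : K) : dd x u (fun=> c) = 0.
Proof. by apply: big1 => a _; rewrite /pd derive_cst mulr0. Qed.

Lemma ddD f h x u : smooth Om f -> smooth Om h -> Om x ->
  dd x u (fun y => f y + h y) = dd x u f + dd x u h.
Proof.
move=> sf sh Ox; rewrite /dd -big_split; apply: eq_bigr => a _ /=.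
by rewrite /pd [X in _ * X]deriveD ?mulrDr //; apply: smooth_derivable Ox.
Qed.

Lemma ddM f h x u : smooth Om f -> smooth Om h -> Om x ->
  dd x u (fun y => f y * h y) = f x * dd x u h + h x * dd x u f.
Proof.
move=> sf sh Ox; rewrite /dd !mulr_sumr -big_split; apply: eq_bigr => a _ /=.
rewrite /pd [X in _ * X]deriveM; try exact: smooth_derivable Ox.
by rewrite /GRing.scale /=; ring.
Qed.

Lemma dd_sum (I : Type) (r : seq I) (F : I -> V -> K) x u :
  (forall i, smooth Om (F i)) -> Om x ->
  dd x u (fun y => \sum_(i <- r) F i y) = \sum_(i <- r) dd x u (F i).
Proof.
move=> sF Ox; elim: r => [|i r IH].
  by rewrite big_nil -[RHS](dd_cst x u 0); apply: dd_eq => // y _; rewrite big_nil.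
rewrite big_cons -IH -ddD //; last exact: smooth_sum.
by apply: dd_eq => // y _; rewrite big_cons.
Qed.

Lemma ddv_eq X Y x u : Om x -> (forall y, Om y -> X y = Y y) -> ddv x u X = ddv x u Y.
Proof. by move=> Ox XY; apply/rowP => k; rewrite !mxE; apply: dd_eq => // y /XY ->. Qed.

Lemma ddv_linear x Y : linear (fun u => ddv x u Y).
Proof. by move=> k u v; apply/rowP => j; rewrite !mxE dd_scalar. Qed.

Lemma ddv_cst x u v : ddv x u (fun=> v) = 0.
Proof. by apply/rowP => k; rewrite !mxE dd_cst. Qed.

Lemma ddvD X Y x u : smooth_field Om X -> smooth_field Om Y -> Om x ->
  ddv x u (fun y => X y + Y y) = ddv x u X + ddv x u Y.
Proof.
move=> sX sY Ox; apply/rowP => k; rewrite !mxE -ddD //.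
by apply: dd_eq => // y _; rewrite mxE.
Qed.

Lemma ddvZ c X x u : smooth_field Om X -> Om x ->
  ddv x u (fun y => c *: X y) = c *: ddv x u X.
Proof.
move=> sX Ox; apply/rowP => k; rewrite !mxE.
have -> : dd x u (fun y => (c *: X y) 0 k) = dd x u (fun y => c * X y 0 k).
  by apply: dd_eq => // y _; rewrite mxE.
by rewrite ddM //; [rewrite dd_cst mulr0 addr0|apply: smooth_cst].
Qed.

Lemma smooth_field_eq X Y : smooth_field Om X -> (forall x, Om x -> X x = Y x) ->
  smooth_field Om Y.
Proof. by move=> sX XY a; apply: (smooth_eq Oo (sX a)) => x /XY ->. Qed.

Lemma smooth_field_cst v : smooth_field Om (fun=> v).
Proof. by move=> a; apply: smooth_cst. Qed.

Lemma smooth_fieldD X Y : smooth_field Om X -> smooth_field Om Y ->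
  smooth_field Om (fun x => X x + Y x).
Proof.
move=> sX sY a; apply: (smooth_eq Oo (smoothD Oo (sX a) (sY a))) => x _.
by rewrite mxE.
Qed.

Lemma smooth_fieldZ c X : smooth_field Om X -> smooth_field Om (fun x => c *: X x).
Proof.
move=> sX a; apply: (smooth_eq Oo (smoothM Oo (@smooth_cst _ _ _ c) (sX a))) => x _.
by rewrite mxE.
Qed.

Lemma smooth_fieldN X : smooth_field Om X -> smooth_field Om (fun x => - X x).
Proof.
by move=> sX; apply: (smooth_field_eq (smooth_fieldZ (-1) sX)) => x _; rewrite scaleN1r.
Qed.

Lemma smooth_dd X f : smooth_field Om X -> smooth Om f ->
  smooth Om (fun x => dd x (X x) f).
Proof.
by move=> sX sf; apply: smooth_sum => // a _; apply: smoothM => //; apply: smooth_pd.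
Qed.

Lemma smooth_ddv X Y : smooth_field Om X -> smooth_field Om Y ->
  smooth_field Om (fun x => ddv x (X x) Y).
Proof.
move=> sX sY k; apply: (smooth_eq Oo (smooth_dd sX (sY k))) => x _.
by rewrite mxE.
Qed.

(** A smooth 1-form on [Om], as a family of linear forms whose smoothness is tested on the basis.
    The bundles below encode endomorphisms, bilinear forms and products in the same way. *)
Definition form_bundle (l : V -> V -> K) := (forall x, Om x -> scalar (l x)) /\
  forall a, smooth Om (fun x => l x (basis_vec K a)).

Lemma smooth_form_app l Z : form_bundle l -> smooth_field Om Z ->
  smooth Om (fun x => l x (Z x)).
Proof.
move=> [ll sl] sZ.
have s : smooth Om (fun x => \sum_a Z x 0 a * l x (basis_vec K a)).
  by apply: smooth_sum => // a _; apply: smoothM.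
by apply: (smooth_eq Oo s) => x Ox; rewrite -scalar_fun_expand //; apply: ll.
Qed.

(** Leibniz rule with the field frozen at its value [Z x] in the first term, obtained by expanding
    in the basis. *)
Lemma dd_form_app l Z x u : form_bundle l -> smooth_field Om Z -> Om x ->
  dd x u (fun y => l y (Z y)) = dd x u (fun y => l y (Z x)) + l x (ddv x u Z).
Proof.
move=> [ll sl] sZ Ox.
have expand Z' : smooth_field Om Z' -> dd x u (fun y => l y (Z' y)) =
    \sum_a (Z' x 0 a * dd x u (fun y => l y (basis_vec K a)) +
            l x (basis_vec K a) * dd x u (fun y => Z' y 0 a)).
  move=> sZ'; have -> : dd x u (fun y => l y (Z' y)) =
      dd x u (fun y => \sum_a Z' y 0 a * l y (basis_vec K a)).
    by apply: dd_eq => // y Oy; rewrite -scalar_fun_expand //; apply: ll.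
  rewrite dd_sum // => [|a]; last by apply: smoothM.
  by apply: eq_bigr => a _; rewrite ddM.
rewrite expand // (expand (fun=> Z x)); last exact: smooth_field_cst.
rewrite (scalar_fun_expand (ddv x u Z) (ll x Ox)) -big_split; apply: eq_bigr => a _ /=.
by rewrite dd_cst !mxE; ring.
Qed.

Definition map_bundle (l : V -> V -> V) := (forall x, Om x -> linear (l x)) /\
  forall a, smooth_field Om (fun x => l x (basis_vec K a)).

Lemma map_bundle_coord l k : map_bundle l -> form_bundle (fun x v => l x v 0 k).
Proof.
move=> [ll sl]; split=> [x Ox a u v|a]; last exact: sl.
by rewrite ll // !mxE.
Qed.

Lemma smooth_map_app l Z : map_bundle l -> smooth_field Om Z ->
  smooth_field Om (fun x => l x (Z x)).
Proof. by move=> bl sZ k; exact: (smooth_form_app (map_bundle_coord k bl) sZ). Qed.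

Lemma ddv_map_app l Z x u : map_bundle l -> smooth_field Om Z -> Om x ->
  ddv x u (fun y => l y (Z y)) = ddv x u (fun y => l y (Z x)) + l x (ddv x u Z).
Proof.
move=> bl sZ Ox; apply/rowP => k; rewrite !mxE.
by rewrite (dd_form_app _ (map_bundle_coord k bl)).
Qed.

Definition form2_bundle (b : V -> V -> V -> K) :=
  [/\ forall x u, Om x -> scalar (b x u), forall x v, Om x -> scalar (fun u => b x u v) &
      forall a c, smooth Om (fun x => b x (basis_vec K a) (basis_vec K c))].

Lemma form2_bundle_l b Y : form2_bundle b -> smooth_field Om Y ->
  form_bundle (fun x v => b x (Y x) v).
Proof.
move=> [lr ll sb] sY; split=> [x Ox|c]; first exact: lr.
apply: (@smooth_form_app (fun x u => b x u (basis_vec K c))) => //.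
by split=> [x Ox|a]; [apply: ll|apply: sb].
Qed.

Lemma form2_bundle_r b Z : form2_bundle b -> smooth_field Om Z ->
  form_bundle (fun x u => b x u (Z x)).
Proof.
move=> [lr ll sb] sZ; split=> [x Ox|c]; first exact: ll.
apply: (@smooth_form_app (fun x v => b x (basis_vec K c) v)) => //.
by split=> [x Ox|a]; [apply: lr|apply: sb].
Qed.

Lemma smooth_form2_app b Y Z : form2_bundle b -> smooth_field Om Y ->
  smooth_field Om Z -> smooth Om (fun x => b x (Y x) (Z x)).
Proof. by move=> bb sY sZ; exact: (smooth_form_app (form2_bundle_l bb sY) sZ). Qed.

Lemma dd_form2_app b Y Z x u : form2_bundle b -> smooth_field Om Y ->
  smooth_field Om Z -> Om x ->
  dd x u (fun y => b y (Y y) (Z y)) = dd x u (fun y => b y (Y x) (Z x)) +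
    b x (ddv x u Y) (Z x) + b x (Y x) (ddv x u Z).
Proof.
move=> bb sY sZ Ox; rewrite (dd_form_app _ (form2_bundle_l bb sY)) //.
congr (_ + _); have bZ := form2_bundle_r bb (smooth_field_cst (Z x)).
exact: (dd_form_app u bZ sY Ox).
Qed.

Definition map2_bundle (b : V -> V -> V -> V) :=
  [/\ forall x u, Om x -> linear (b x u), forall x v, Om x -> linear (fun u => b x u v) &
      forall a c, smooth_field Om (fun x => b x (basis_vec K a) (basis_vec K c))].

Lemma map2_bundle_coord b k : map2_bundle b -> form2_bundle (fun x u v => b x u v 0 k).
Proof.
move=> [lr ll sb]; split=> [x u Ox a v w|x v Ox a u w|a c]; last exact: sb.
  by rewrite lr // !mxE.
by rewrite ll // !mxE.
Qed.

Lemma smooth_map2_app b Y Z : map2_bundle b -> smooth_field Om Y ->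
  smooth_field Om Z -> smooth_field Om (fun x => b x (Y x) (Z x)).
Proof.
move=> bb sY sZ k.
exact: (smooth_form2_app (map2_bundle_coord k bb) sY sZ).
Qed.

Lemma ddv_map2_app b Y Z x u : map2_bundle b -> smooth_field Om Y ->
  smooth_field Om Z -> Om x ->
  ddv x u (fun y => b y (Y y) (Z y)) = ddv x u (fun y => b y (Y x) (Z x)) +
    b x (ddv x u Y) (Z x) + b x (Y x) (ddv x u Z).
Proof.
move=> bb sY sZ Ox; apply/rowP => k; rewrite !mxE.
by rewrite (dd_form2_app _ (map2_bundle_coord k bb)).
Qed.

End Derivations.

(** * Levi-Civita connections *)

Section Connections.
Variables (K : numFieldType) (n : nat) (Om : set 'rV[K]_n).
Hypothesis Oo : open Om.
Local Notation V := 'rV[K]_n.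
Implicit Types (X Y Z W : V -> V) (u v w x p q : V).

Lemma dd_basis x a (f : V -> K) : dd x (basis_vec K a) f = pd a f x.
Proof.
rewrite /dd (bigD1 a) //= big1 => [|c ca]; first by rewrite mxE !eqxx mul1r addr0.
by rewrite mxE (negPf ca) andbF mul0r.
Qed.

Lemma bracketE X Y x : bracket X Y x = ddv x (X x) Y - ddv x (Y x) X.
Proof. by apply/rowP => k; rewrite !mxE. Qed.

(** [Gam] holds the Christoffel symbols as a bilinear operation and is kept arbitrary, so that the
    original and the dual connection are both instances. *)
Definition conn (Gam : V -> V -> V -> V) x u Y := ddv x u Y + Gam x u (Y x).

Definition levi_civita (g : V -> V -> V -> K) x u v : V :=
  \row_k \sum_a \sum_c christoffel g x a c k * u 0 a * v 0 c.

Lemma nablaE g X Y : nabla g X Y = fun x => conn (levi_civita g) x (X x) Y.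
Proof. by apply/funext => x; apply/rowP => k; rewrite !mxE. Qed.

Section LeviCivita.
Variable g : V -> V -> V -> K.
Hypothesis bg : form2_bundle Om g.
Hypothesis g_sym : forall x, Om x -> forall u v, g x u v = g x v u.
Hypothesis g_nondeg : forall x, Om x -> nondegenerate (g x).

Let glr x (Ox : Om x) u : scalar (g x u). Proof. by case: bg => + _ _; apply. Qed.
Let gll x (Ox : Om x) v : scalar (g x ^~ v). Proof. by case: bg => _ + _; apply. Qed.
Let ug x : Om x -> gram (g x) \in unitmx.
Proof. by move=> Ox; apply: gram_unitmx; [exact: glr|exact: gll|exact: g_nondeg]. Qed.

Let kap x u v w := dd x u (fun y => g y v w).

Let kap_expand x u v w : Om x -> kap x u v w =
  \sum_a \sum_c v 0 a * w 0 c * dd x u (metric_comp g a c).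
Proof.
move=> Ox.
have -> : kap x u v w = dd x u (fun y => \sum_a \sum_c v 0 a * w 0 c * metric_comp g a c y).
  apply: (dd_eq Oo) => // y Oy; rewrite (scalar_fun_expand v (gll Oy w)).
  apply: eq_bigr => a _; rewrite (scalar_fun_expand w (glr Oy _)) mulr_sumr.
  by apply: eq_bigr => c _; rewrite mulrA /metric_comp mxE.
have sg a c : smooth Om (metric_comp g a c).
  have [_ _ sb] := bg.
  by apply: (smooth_eq Oo (sb a c)) => y _; rewrite /metric_comp mxE.
have st a c : smooth Om (fun y => v 0 a * w 0 c * metric_comp g a c y).
  by apply: smoothM => //; apply: smooth_cst.
rewrite (dd_sum Oo) // => [|a]; last by apply: smooth_sum.
apply: eq_bigr => a _; rewrite (dd_sum Oo) //; apply: eq_bigr => c _.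
by rewrite (ddM (Om := Om)) //; [rewrite dd_cst mulr0 addr0|apply: smooth_cst].
Qed.

Let kap_sym x u v w : Om x -> kap x u v w = kap x u w v.
Proof. by move=> Ox; apply: (dd_eq Oo) => // y Oy; apply: g_sym. Qed.

Let kap_basis x u v l : Om x -> kap x u v (basis_vec K l) =
  \sum_a v 0 a * dd x u (metric_comp g a l).
Proof.
move=> Ox; rewrite kap_expand //; apply: eq_bigr => a _.
rewrite (bigD1 l) //= big1 => [|c cl]; first by rewrite mxE !eqxx mulr1 addr0.
by rewrite mxE (negPf cl) andbF mulr0 mul0r.
Qed.

Let gram_sym x : Om x -> (invmx (gram (g x)))^T = invmx (gram (g x)).
Proof.
move=> Ox; rewrite trmx_inv; congr invmx; apply/matrixP => a c.
by rewrite !mxE g_sym.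
Qed.

(** The coordinate formula regrouped as the Koszul covector raised by the inverse Gram matrix. *)
Lemma levi_civitaE x u v : Om x -> levi_civita g x u v =
  (\row_l (2^-1 * (kap x u v (basis_vec K l) + kap x v u (basis_vec K l)
    - kap x (basis_vec K l) u v))) *m invmx (gram (g x)).
Proof.
move=> Ox; apply/rowP => k; rewrite !mxE.
under eq_bigr => a _.
  under eq_bigr => c _.
    rewrite /christoffel mulr_sumr !mulr_suml.
    over.
  rewrite exchange_big.
  over.
rewrite exchange_big; apply: eq_bigr => l _ /=.
rewrite mxE !kap_basis // kap_expand //.
have -> : \sum_a v 0 a * dd x u (metric_comp g a l) =
    \sum_a \sum_c u 0 a * v 0 c * pd a (metric_comp g c l) x.
  rewrite exchange_big; apply: eq_bigr => c _; rewrite /dd mulr_sumr.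
  by apply: eq_bigr => a _; ring.
have -> : \sum_a u 0 a * dd x v (metric_comp g a l) =
    \sum_a \sum_c u 0 a * v 0 c * pd c (metric_comp g a l) x.
  by apply: eq_bigr => a _; rewrite /dd mulr_sumr; apply: eq_bigr => c _; ring.
have -> : invmx (gram (g x)) l k = invmx (gram (g x)) k l.
  by rewrite -[in RHS]gram_sym // mxE.
rewrite -big_split -sumrB mulr_sumr mulr_suml; apply: eq_bigr => a _.
rewrite -big_split -sumrB mulr_sumr mulr_suml; apply: eq_bigr => c _.
by rewrite dd_basis /=; ring.
Qed.

(** The Koszul formula for constant fields, whose brackets vanish. *)
Lemma koszul x u v w : Om x -> g x (levi_civita g x u v) w =
  2^-1 * (kap x u v w + kap x v u w - kap x w u v).
Proof.
move=> Ox; rewrite levi_civitaE // (gramE _ _ (glr Ox) (gll Ox)) mulmxKV ?ug // mxE.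
have kap_linr u' v' : kap x u' v' w = \sum_l w 0 l * kap x u' v' (basis_vec K l).
  rewrite kap_expand // exchange_big; apply: eq_bigr => l _ /=.
  by rewrite kap_basis // mulr_sumr; apply: eq_bigr => a _; ring.
rewrite (kap_linr u v) (kap_linr v u) [kap x w u v](scalar_fun_expand w (dd_scalar x _)).
rewrite -big_split -sumrB mulr_sumr; apply: eq_bigr => l _.
by rewrite !mxE /kap /=; ring.
Qed.

Lemma levi_civita_sym x u v : Om x -> levi_civita g x u v = levi_civita g x v u.
Proof.
move=> Ox; apply/eqP; rewrite -subr_eq0; apply/eqP; apply: (g_nondeg Ox) => w.
rewrite (linear_funD (gll Ox w)) (linear_funN (gll Ox w)) !koszul //.
by rewrite (kap_sym w u v) //; ring.
Qed.

Lemma levi_civita_compat x u v w : Om x -> dd x u (fun y => g y v w) =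
  g x (levi_civita g x u v) w + g x v (levi_civita g x u w).
Proof.
move=> Ox; rewrite [X in _ + X]g_sym // !koszul // -/(kap x u v w).
rewrite (kap_sym u w v) // (kap_sym w u v) // (kap_sym v u w) //.
by field.
Qed.

(** Substituting compatibility into the three terms of the Koszul formula leaves only g(C u v, w),
    by symmetry of [C]. *)
Lemma levi_civita_unique x (C : V -> V -> V) : Om x ->
  (forall u v, C u v = C v u) ->
  (forall u v w, dd x u (fun y => g y v w) = g x (C u v) w + g x v (C u w)) ->
  levi_civita g x = C.
Proof.
move=> Ox C_sym C_compat; apply/funext => u; apply/funext => v.
apply/eqP; rewrite -subr_eq0; apply/eqP; apply: (g_nondeg Ox) => w.
rewrite (linear_funD (gll Ox w)) (linear_funN (gll Ox w)) koszul // /kap !C_compat.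
rewrite (g_sym Ox v (C u w)) (g_sym Ox u (C v w)) (g_sym Ox u (C w v)).
rewrite (C_sym w u) (C_sym v u) (C_sym w v).
by field.
Qed.

Lemma levi_civita_bundle : map2_bundle Om (levi_civita g).
Proof.
split.
- move=> x u _ k v w; apply/rowP => l; rewrite !mxE mulr_sumr -big_split /=.
  apply: eq_bigr => a _; rewrite mulr_sumr -big_split; apply: eq_bigr => c _ /=.
  by rewrite !mxE; ring.
- move=> x w _ k u v; apply/rowP => l; rewrite !mxE mulr_sumr -big_split /=.
  apply: eq_bigr => a _; rewrite mulr_sumr -big_split; apply: eq_bigr => c _ /=.
  by rewrite !mxE; ring.
move=> a c k.
have sg i j : smooth Om (metric_comp g i j).
  have [_ _ sb] := bg.
  by apply: (smooth_eq Oo (sb i j)) => y _; rewrite /metric_comp mxE.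
have s : smooth Om (fun x => \sum_a' \sum_c' christoffel g x a' c' k *
    basis_vec K a 0 a' * basis_vec K c 0 c').
  apply: smooth_sum => // a' _; apply: smooth_sum => // c' _.
  do 2![apply: smoothM => //; last exact: smooth_cst].
  apply: smoothM => //; first exact: smooth_cst.
  apply: smooth_sum => // l _; apply: smoothM => //; first exact: smooth_invmx.
  by apply: smoothB => //; [apply: smoothD => //|]; apply: smooth_pd.
by apply: (smooth_eq Oo s) => x _; rewrite mxE.
Qed.

End LeviCivita.

End Connections.

(** * Calculus of a torsion-free connection: Leibniz rules, brackets and curvature *)

Section ConnectionCalculus.
Variables (K : numFieldType) (n : nat) (Om : set 'rV[K]_n).
Hypothesis Oo : open Om.
Local Notation V := 'rV[K]_n.
Variable Gam : V -> V -> V -> V.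
Hypothesis bGam : map2_bundle Om Gam.
Hypothesis Gam_sym : forall x, Om x -> forall u v, Gam x u v = Gam x v u.
Implicit Types (X Y Z W : V -> V) (u v w x p q r : V).

Let Glr x (Ox : Om x) u : linear (Gam x u). Proof. by case: bGam => + _ _; apply. Qed.
Let Gll x (Ox : Om x) v : linear (Gam x ^~ v). Proof. by case: bGam => _ + _; apply. Qed.

Lemma conn_linear x Y : Om x -> linear (fun u => conn Gam x u Y).
Proof.
by move=> Ox k u v; rewrite /conn ddv_linear (Gll Ox) scalerDr addrACA.
Qed.

Lemma conn_eq X Y x u : Om x -> (forall y, Om y -> X y = Y y) ->
  conn Gam x u X = conn Gam x u Y.
Proof. by move=> Ox XY; rewrite /conn (ddv_eq Oo _ Ox XY) XY. Qed.

Lemma connD X Y x u : smooth_field Om X -> smooth_field Om Y -> Om x ->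
  conn Gam x u (fun y => X y + Y y) = conn Gam x u X + conn Gam x u Y.
Proof.
by move=> sX sY Ox; rewrite /conn (ddvD Oo _ sX) // (linear_funD (Glr Ox u)) addrACA.
Qed.

Lemma connZ c X x u : smooth_field Om X -> Om x ->
  conn Gam x u (fun y => c *: X y) = c *: conn Gam x u X.
Proof.
by move=> sX Ox; rewrite /conn (ddvZ Oo _ _ sX) // (linear_funZ (Glr Ox u)) scalerDr.
Qed.

Lemma conn_cst x u v : conn Gam x u (fun=> v) = Gam x u v.
Proof. by rewrite /conn ddv_cst add0r. Qed.

Lemma smooth_conn X Y : smooth_field Om X -> smooth_field Om Y ->
  smooth_field Om (fun x => conn Gam x (X x) Y).
Proof.
by move=> sX sY; apply: smooth_fieldD => //; [apply: smooth_ddv|apply: smooth_map2_app].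
Qed.

Lemma conn_map_bundle Y : smooth_field Om Y ->
  map_bundle Om (fun x u => conn Gam x u Y).
Proof.
move=> sY; split=> [x Ox|a]; first exact: conn_linear.
exact: smooth_conn (@smooth_field_cst _ _ _ _) sY.
Qed.

Lemma conn_map_app l Z x u : map_bundle Om l -> smooth_field Om Z -> Om x ->
  conn Gam x u (fun y => l y (Z y)) =
  conn Gam x u (fun y => l y (Z x)) - l x (Gam x u (Z x)) + l x (conn Gam x u Z).
Proof.
move=> bl sZ Ox; have [ll _] := bl; rewrite /conn (ddv_map_app Oo _ bl) //.
rewrite (linear_funD (ll x Ox)).
have abel (a b c d : V) : a + b + c = a + c - d + (b + d).
  by apply/rowP => k; rewrite !mxE; ring.
exact: abel.
Qed.

(* The value of [(nabla_u b)(p, q)], computed on the constant fields [p], [q]. *)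
Definition cov2 (b : V -> V -> V -> V) x u p q :=
  conn Gam x u (fun y => b y p q) - b x (Gam x u p) q - b x p (Gam x u q).

(** The Christoffel terms subtracted in [cov2] are those added by the two derivatives, so [cov2],
    computed on constant fields, serves for all fields. *)
Lemma conn_map2_app b Y Z x u : map2_bundle Om b -> smooth_field Om Y ->
  smooth_field Om Z -> Om x ->
  conn Gam x u (fun y => b y (Y y) (Z y)) = cov2 b x u (Y x) (Z x) +
    b x (conn Gam x u Y) (Z x) + b x (Y x) (conn Gam x u Z).
Proof.
move=> bb sY sZ Ox; have [lr ll _] := bb.
rewrite /cov2 /conn (ddv_map2_app Oo _ bb) //.
rewrite (linear_funD (lr x (Y x) Ox)) (linear_funD (ll x (Z x) Ox)).
have abel (a b' c d f g : V) : a + b' + c + d = a + d - f - g + (b' + f) + (c + g).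
  by apply/rowP => k; rewrite !mxE; ring.
exact: abel.
Qed.

Lemma bracket_conn X Y x : Om x ->
  bracket X Y x = conn Gam x (X x) Y - conn Gam x (Y x) X.
Proof.
move=> Ox; rewrite bracketE /conn (Gam_sym Ox (Y x)).
have abel (a b c : V) : a - b = a + c - (b + c).
  by apply/rowP => k; rewrite !mxE; ring.
exact: abel.
Qed.

Lemma dd_compat g Y Z x u : form2_bundle Om g ->
  (forall v w, dd x u (fun y => g y v w) = g x (Gam x u v) w + g x v (Gam x u w)) ->
  smooth_field Om Y -> smooth_field Om Z -> Om x ->
  dd x u (fun y => g y (Y y) (Z y)) =
  g x (conn Gam x u Y) (Z x) + g x (Y x) (conn Gam x u Z).
Proof.
move=> bg cg sY sZ Ox; have [lr ll _] := bg.
rewrite (dd_form2_app Oo _ bg) // cg /conn.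
rewrite (linear_funD (lr x (Y x) Ox)) (linear_funD (ll x (Z x) Ox)); ring.
Qed.

(** Since the metric is parallel, differentiating c = g(b(X, Y), Z) leaves only the derivative of
    the product. *)
Lemma nabla_cE g b W X Y Z x : form2_bundle Om g -> map2_bundle Om b ->
  levi_civita g x = Gam x ->
  (forall u v w, dd x u (fun y => g y v w) = g x (Gam x u v) w + g x v (Gam x u w)) ->
  smooth_field Om X -> smooth_field Om Y -> smooth_field Om Z -> Om x ->
  nabla_c b g W X Y Z x = g x (cov2 b x (W x) (X x) (Y x)) (Z x).
Proof.
move=> bg bb gE cg sX sY sZ Ox; have [lr ll _] := bg.
rewrite /nabla_c !nablaE /c_tensor /metf /mulf /conn gE -/(conn Gam _ _ _).
rewrite -[vf_apply _ _ _]/(dd x (W x) (fun y => g y (b y (X y) (Y y)) (Z y))).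
rewrite (dd_compat (Y := fun y => b y (X y) (Y y)) bg) //; last exact: smooth_map2_app.
rewrite (conn_map2_app _ bb) //.
have glD := linear_funD (ll x (Z x) Ox).
by rewrite !glD /conn; ring.
Qed.

Lemma ddv_comm (Z : V -> V) x p q :
  (forall f a c, smooth Om f -> pd a (pd c f) x = pd c (pd a f) x) ->
  smooth_field Om Z -> Om x ->
  ddv x p (fun y => ddv y q Z) = ddv x q (fun y => ddv y p Z).
Proof.
move=> schw sZ Ox; apply/rowP => k; rewrite !mxE.
have expand p' q' : dd x p' (fun y => ddv y q' Z 0 k) =
    \sum_a \sum_c p' 0 a * q' 0 c * pd a (pd c (fun y => Z y 0 k)) x.
  have -> : dd x p' (fun y => ddv y q' Z 0 k) =
      dd x p' (fun y => \sum_c q' 0 c * pd c (fun y => Z y 0 k) y).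
    by apply: (dd_eq Oo) => // y _; rewrite mxE.
  have spd c : smooth Om (pd c (fun y => Z y 0 k)) by apply: smooth_pd.
  rewrite (dd_sum Oo) // => [|c]; last by apply: smoothM => //; apply: smooth_cst.
  rewrite [RHS]exchange_big; apply: eq_bigr => c _ /=.
  rewrite (ddM (Om := Om)) //; last exact: smooth_cst.
  rewrite dd_cst mulr0 addr0 mulr_sumr; apply: eq_bigr => a _; ring.
rewrite !expand exchange_big; apply: eq_bigr => c _; apply: eq_bigr => a _ /=.
by rewrite schw //; ring.
Qed.

(** Curvature is tensorial: its vanishing on constant fields, the second hypothesis, extends to
    arbitrary fields once mixed derivatives of [Z] commute. *)
Lemma curvature_eq0 X Y Z x :
  (forall f a c, smooth Om f -> pd a (pd c f) x = pd c (pd a f) x) ->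
  (forall p q r, conn Gam x p (fun y => Gam y q r) = conn Gam x q (fun y => Gam y p r)) ->
  smooth_field Om X -> smooth_field Om Y -> smooth_field Om Z -> Om x ->
  conn Gam x (X x) (fun y => conn Gam y (Y y) Z) -
  conn Gam x (Y x) (fun y => conn Gam y (X y) Z) -
  conn Gam x (bracket X Y x) Z = 0.
Proof.
move=> schw flat sX sY sZ Ox.
have bZ : map_bundle Om (fun x u => ddv x u Z).
  split=> [y _|a]; first exact: ddv_linear.
  exact: smooth_ddv (@smooth_field_cst _ _ _ _) sZ.
(* The summands are a second derivative of [Z], the expression on frozen fields, a term completed by
   the bracket, and a pair symmetric in [p] and [Y' x]. *)
have step p Y' : smooth_field Om Y' -> conn Gam x p (fun y => conn Gam y (Y' y) Z) =
    ddv x p (fun y => ddv y (Y' x) Z) + conn Gam x p (fun y => Gam y (Y' x) (Z x)) +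
    conn Gam x (ddv x p Y') Z + (Gam x (Y' x) (ddv x p Z) + Gam x p (ddv x (Y' x) Z)).
  move=> sY'; rewrite /conn.
  rewrite (ddvD Oo _ (smooth_map_app Oo bZ sY') (smooth_map2_app Oo bGam sY' sZ)) //.
  rewrite (ddv_map_app Oo _ bZ) // (ddv_map2_app Oo _ bGam) //.
  rewrite (linear_funD (Glr Ox p)).
  have abel (a b c d f g h : V) : a + b + (c + d + f) + (g + h) =
      a + (c + h) + (b + d) + (f + g).
    by apply/rowP => k; rewrite !mxE; ring.
  exact: abel.
rewrite !step // bracketE (linear_funD (conn_linear Z Ox)) (linear_funN (conn_linear Z Ox)).
rewrite (ddv_comm (X x)) // flat.
have abel (a b c d f g : V) : a + b + c + (d + f) - (a + b + g + (f + d)) - (c - g) = 0.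
  by apply/rowP => k; rewrite !mxE; ring.
exact: abel.
Qed.

End ConnectionCalculus.

(** * Frobenius structures in a chart *)

Section LocalFacts.
Variables (K : numFieldType) (n : nat) (Om : set 'rV[K]_n).
Hypothesis Oo : open Om.
Local Notation V := 'rV[K]_n.
Variables (D : frob_data K n) (d : K).
Local Notation m := (fmul D).
Local Notation g := (fmetric D).
Local Notation e := (funit D).
Local Notation E := (feuler D).
Hypothesis sD : smooth_data Om D.
Hypothesis FA : forall x, Om x -> frobenius_algebra (m x) (e x) (g x).
Implicit Types (X Y Z W : V -> V) (u v w x p q r : V).

Lemma fmul_bundle : map2_bundle Om m.
Proof.
case: sD => sm _ _ _; split=> [x u Ox|x v Ox|a c j]; last exact: sm.
  exact: frob_linr (FA Ox) u.
exact: frob_linl (FA Ox) v.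
Qed.

Lemma fmetric_bundle : form2_bundle Om g.
Proof.
case: sD => _ sg _ _; split=> [x u Ox|x v Ox|a c]; last exact: sg.
  exact: form_linr (FA Ox) u.
exact: form_linl (FA Ox) v.
Qed.

Let gsym x (Ox : Om x) u v : g x u v = g x v u. Proof. exact: form_sym (FA Ox) u v. Qed.
Let gnd x (Ox : Om x) : nondegenerate (g x). Proof. exact: form_nondeg (FA Ox). Qed.

Let Gam := levi_civita g.
Let bGam : map2_bundle Om Gam := levi_civita_bundle Oo fmetric_bundle gnd.
Let Gsym x (Ox : Om x) u v : Gam x u v = Gam x v u :=
  levi_civita_sym Oo fmetric_bundle gsym gnd u v Ox.
Let Gcomp x (Ox : Om x) u v w := levi_civita_compat Oo fmetric_bundle gsym gnd u v w Ox.

Lemma dd_metric Y Z x u : smooth_field Om Y -> smooth_field Om Z -> Om x ->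
  dd x u (fun y => g y (Y y) (Z y)) =
  g x (conn Gam x u Y) (Z x) + g x (Y x) (conn Gam x u Z).
Proof. by move=> sY sZ Ox; apply: (dd_compat Oo fmetric_bundle) => // v w; apply: Gcomp. Qed.

Lemma cov2_comm x w u v : Om x -> cov2 Gam m x w u v = cov2 Gam m x w v u.
Proof.
move=> Ox; rewrite /cov2.
have -> : conn Gam x w (fun y => m y u v) = conn Gam x w (fun y => m y v u).
  by apply: (conn_eq Oo) => // y Oy; apply: frob_mulC (FA Oy) u v.
by rewrite (frob_mulC (FA Ox) (Gam x w u)) (frob_mulC (FA Ox) u) addrAC.
Qed.

Let nabla_cE' W X Y Z x : smooth_field Om X -> smooth_field Om Y ->
  smooth_field Om Z -> Om x ->
  nabla_c m g W X Y Z x = g x (cov2 Gam m x (W x) (X x) (Y x)) (Z x).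
Proof.
move=> sX sY sZ Ox; apply: (nabla_cE Oo) => //; [exact: fmetric_bundle|exact: fmul_bundle|].
by move=> u v w; apply: Gcomp.
Qed.

Lemma cov2_sym x w u v : nabla_c_symmetric Om m g -> Om x ->
  cov2 Gam m x w u v = cov2 Gam m x u w v.
Proof.
move=> NC Ox; apply/eqP; rewrite -subr_eq0; apply/eqP; apply: (gnd Ox) => z.
have gl := form_linl (FA Ox) z; rewrite (linear_funD gl) (linear_funN gl).
have cs p : smooth_field Om (fun=> p) := @smooth_field_cst _ _ _ p.
have [+ _ _] := NC _ _ _ _ (cs w) (cs u) (cs v) (cs z) x Ox.
by rewrite !nabla_cE' // => ->; rewrite subrr.
Qed.

(** The other two transpositions are automatic, because c is itself symmetric by commutativity and
    invariance of the form. *)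
Lemma nabla_c_symmetric_cov2 :
  (forall x w u v, Om x -> cov2 Gam m x w u v = cov2 Gam m x u w v) ->
  nabla_c_symmetric Om m g.
Proof.
move=> cs W X Y Z sW sX sY sZ x Ox; split.
- by rewrite !nabla_cE' // cs.
- by rewrite !nabla_cE' // cov2_comm.
have cYZ U1 U2 U3 y : Om y -> c_tensor m g U1 U2 U3 y = c_tensor m g U1 U3 U2 y.
  move=> Oy; rewrite /c_tensor /metf /mulf !(form_frob (FA Oy)).
  by rewrite (frob_mulC (FA Oy)).
rewrite /nabla_c (cYZ (nabla g W X) Y) // (cYZ X (nabla g W Y)) // (cYZ X Y (nabla g W Z)) //.
have -> : vf_apply W (c_tensor m g X Y Z) x = vf_apply W (c_tensor m g X Z Y) x.
  exact: (dd_eq Oo (W x) Ox (fun y => @cYZ X Y Z y)).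
ring.
Qed.

(** Differentiate the associative law on constant fields; the Christoffel terms cancel by
    associativity at the point. *)
Lemma cov2_assoc x w u v z : Om x ->
  cov2 Gam m x w (m x u v) z + m x (cov2 Gam m x w u v) z =
  cov2 Gam m x w u (m x v z) + m x u (cov2 Gam m x w v z).
Proof.
move=> Ox; have cs p : smooth_field Om (fun=> p) := @smooth_field_cst _ _ _ p.
have sm p q : smooth_field Om (fun y => m y p q).
  exact (smooth_map2_app Oo fmul_bundle (cs p) (cs q)).
have mE p q : conn Gam x w (fun y => m y p q) =
    cov2 Gam m x w p q + m x (Gam x w p) q + m x p (Gam x w q).
  by rewrite (conn_map2_app Oo Gam _ fmul_bundle (cs p) (cs q)) // !conn_cst.
have : conn Gam x w (fun y => m y (m y u v) z) = conn Gam x w (fun y => m y u (m y v z)).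
  by apply: (conn_eq Oo) => // y Oy; rewrite (frob_mulA (FA Oy)).
rewrite (conn_map2_app Oo Gam _ fmul_bundle (sm u v) (cs z)) //.
rewrite (conn_map2_app Oo Gam _ fmul_bundle (cs u) (sm v z)) // !mE !conn_cst.
have ringA (N1 N2 N3 N4 a b c p q r : frob_ring (FA Ox)) :
    N1 + (N2 + a * q + p * b) * r + p * q * c = N3 + a * (q * r) + p * (N4 + b * r + q * c) ->
    N1 + N2 * r = N3 + p * N4.
  move=> h; have -> : N1 + N2 * r = N1 + (N2 + a * q + p * b) * r + p * q * c
    - a * (q * r) - p * (b * r) - p * (q * c) by ring.
  by rewrite h; ring.
exact: ringA.
Qed.

Lemma cov2_unit x w q : parallel_field Om g e -> Om x -> cov2 Gam m x w (e x) q = 0.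
Proof.
move=> P Ox; have [_ _ se _] := sD.
have cs p : smooth_field Om (fun=> p) := @smooth_field_cst _ _ _ p.
have e0 : conn Gam x w e = 0 by have := P _ (cs w) x Ox; rewrite nablaE.
have := conn_map2_app Oo Gam w fmul_bundle se (cs q) Ox.
rewrite conn_cst e0 (frob_mul1 (FA Ox)) (linear_fun0 (frob_linl (FA Ox) q)) addr0.
have -> : conn Gam x w (fun y => m y (e y) q) = conn Gam x w (fun=> q).
  by apply: (conn_eq Oo) => // y Oy; rewrite (frob_mul1 (FA Oy)).
by rewrite conn_cst => /eqP; rewrite -subr_eq subrr eq_sym => /eqP.
Qed.

(** The Lie identity with each bracket [E, u] rewritten as nabla_E u - nabla_u E; the derivatives
    along E assemble into [cov2]. *)
Lemma cov2_euler x u v : euler_mul Om m E 1 -> Om x -> cov2 Gam m x (E x) u v =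
  m x u v + conn Gam x (m x u v) E - m x (conn Gam x u E) v - m x u (conn Gam x v E).
Proof.
move=> EM Ox; have cs p : smooth_field Om (fun=> p) := @smooth_field_cst _ _ _ p.
have := EM _ _ (cs u) (cs v) x Ox; rewrite scale1r.
rewrite [mulf m (bracket _ _) _ x]/mulf [mulf m _ (bracket _ _) x]/mulf.
rewrite !(bracket_conn Gsym) // !conn_cst.
rewrite (conn_map2_app Oo Gam _ fmul_bundle (cs u) (cs v)) // !conn_cst /mulf.
have ringA (N a b c c' t p q : frob_ring (FA Ox)) :
  N + a * q + p * b - t - (a - c) * q - p * (b - c') = p * q ->
  N = p * q + t - c * q - p * c' by move=> <-; ring.
exact: ringA.
Qed.

Lemma form_euler x u v : euler_metric Om g E d -> Om x ->
  g x (conn Gam x u E) v + g x u (conn Gam x v E) = (2 - d) * g x u v.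
Proof.
move=> EM Ox; have cs p : smooth_field Om (fun=> p) := @smooth_field_cst _ _ _ p.
have := EM _ _ (cs u) (cs v) x Ox; rewrite /metf.
rewrite -[vf_apply _ _ _]/(dd x (E x) (fun y => g y u v)) (dd_metric _ (cs u) (cs v)) //.
rewrite !(bracket_conn Gsym) // !conn_cst.
have gl := form_linl (FA Ox) v; have gr := form_linr (FA Ox) u.
rewrite (linear_funD gl) (linear_funN gl) (linear_funD gr) (linear_funN gr) => <-.
ring.
Qed.

(** Linearity of E on constant fields, in the form that makes nabla E a parallel endomorphism. *)
Lemma conn_euler x u q : linear_field Om g E -> Om x ->
  conn Gam x u (fun y => conn Gam y q E) = conn Gam x (Gam x u q) E.
Proof.
move=> LE Ox; have cs p : smooth_field Om (fun=> p) := @smooth_field_cst _ _ _ p.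
have := LE _ _ (cs u) (cs q) x Ox; rewrite !nablaE conn_cst => /eqP.
by rewrite subr_eq0 => /eqP.
Qed.

Lemma conn_flat x p q r : flat_metric Om g -> Om x ->
  conn Gam x p (fun y => Gam y q r) = conn Gam x q (fun y => Gam y p r).
Proof.
move=> FM Ox; have cs v : smooth_field Om (fun=> v) := @smooth_field_cst _ _ _ v.
have := FM _ _ _ (cs p) (cs q) (cs r) x Ox; rewrite !nablaE.
rewrite bracketE !ddv_cst subrr (linear_fun0 (conn_linear bGam _ Ox)) subr0.
have cE v : (fun y => conn Gam y v (fun=> r)) = fun y => Gam y v r.
  by apply/funext => y; rewrite conn_cst.
by rewrite !cE => /eqP; rewrite subr_eq0 => /eqP.
Qed.

End LocalFacts.

(** * The dual structure in a chart *)

Lemma smooth_data_sub (K : numFieldType) n (Om Om' : set 'rV[K]_n) (D : frob_data K n) :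
  Om' `<=` Om -> smooth_data Om D -> smooth_data Om' D.
Proof.
move=> sub [s1 s2 s3 s4]; split.
- by move=> a c k; apply: smooth_sub sub (s1 a c k).
- by move=> a c; apply: smooth_sub sub (s2 a c).
- by move=> a; apply: smooth_sub sub (s3 a).
- by move=> a; apply: smooth_sub sub (s4 a).
Qed.

Section DualStructure.
(** [Om] will be the chart image of the whole manifold and [U] its part off the discriminant. The
    axioms speak of fields on [Om], the conclusions of fields on [U]; constant fields, smooth on
    both, carry the identities across. *)
Variables (K : numFieldType) (n : nat) (Om U : set 'rV[K]_n).
Hypotheses (Oo : open Om) (Uo : open U) (sub : U `<=` Om).
Local Notation V := 'rV[K]_n.
Variables (D : frob_data K n) (d : K).
Local Notation m := (fmul D).
Local Notation g := (fmetric D).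
Local Notation e := (funit D).
Local Notation E := (feuler D).
Hypothesis frobD : local_frobenius Om 1 d D.
Hypothesis flat_unit : parallel_field Om g e.
Hypothesis schwarzU : forall f x a c, smooth U f -> U x ->
  pd a (pd c f) x = pd c (pd a f) x.
Hypothesis invE : forall x, U x -> exists f, m x (E x) f = e x.
Implicit Types (X Y Z W : V -> V) (u v w x p q r : V).

Let sD : smooth_data Om D. Proof. by case: frobD. Qed.
Let FAO x : Om x -> frobenius_algebra (m x) (e x) (g x).
Proof. by case: frobD => _ + _ _ _; apply. Qed.
Let flatg : flat_metric Om g. Proof. by case: frobD. Qed.
Let symc : nabla_c_symmetric Om m g. Proof. by case: frobD. Qed.
Let linE : linear_field Om g E. Proof. by case: frobD => _ _ _ _ []. Qed.
Let mulE : euler_mul Om m E 1. Proof. by case: frobD => _ _ _ _ []. Qed.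
Let metE : euler_metric Om g E d. Proof. by case: frobD => _ _ _ _ []. Qed.

Let sU : smooth_data U D. Proof. exact: smooth_data_sub sub sD. Qed.
Let FA x (Ux : U x) : frobenius_algebra (m x) (e x) (g x).
Proof. exact: FAO (sub Ux). Qed.
Let bm : map2_bundle U m. Proof. exact (fmul_bundle sU FA). Qed.
Let bg : form2_bundle U g. Proof. exact (fmetric_bundle sU FA). Qed.
Let Gam := levi_civita g.
Let gsym x (Ux : U x) u v : g x u v = g x v u. Proof. exact: form_sym (FA Ux) u v. Qed.
Let gnd x (Ux : U x) : nondegenerate (g x). Proof. exact: form_nondeg (FA Ux). Qed.
Let bGam : map2_bundle U Gam. Proof. exact (levi_civita_bundle Uo bg gnd). Qed.
Let Gam_sym x (Ux : U x) u v : Gam x u v = Gam x v u.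
Proof. exact (levi_civita_sym Uo bg gsym gnd u v Ux). Qed.
Let sE : smooth_field U E. Proof. by case: sU. Qed.
Let se : smooth_field U e. Proof. by case: sU. Qed.
Let cs p : smooth_field U (fun=> p). Proof. exact: smooth_field_cst. Qed.

(** The letters instantiate the pointwise algebra above. [C] is the difference between the dual and
    the original connection, and [Gd] gives the Christoffel symbols of the dual one. *)
Let N := cov2 Gam m.
Let T x u := conn Gam x u E.
Let F x := alg_inv (m x) (e x) (E x).
Let dF x u := conn Gam x u F.
Let beta := (1 - d) / 2.
Let B x q := m x (beta *: e x) q - T x q.
Let G x u v := N x u (F x) v + m x (dF x u) v.
Let C x u v := B x (m x (F x) (m x u v)).
Let Gd x u v := Gam x u v + C x u v.

Let EF x : U x -> m x (E x) (F x) = e x.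
Proof. by move=> Ux; have [f Ef] := invE Ux; rewrite /F (alg_inv_unique (FA Ux) Ef). Qed.

(** [F] solves a linear system: it is [e] times the inverse matrix of multiplication by E, which is
    smooth by Cramer's rule. *)
Lemma smooth_alg_inv : smooth_field U F.
Proof.
have uM x : U x -> mulmatrix (m x) (E x) \in unitmx.
  by move=> Ux; apply: (mulmatrix_inv (FA Ux) (EF Ux)).
have sM a c : smooth U (fun x => mulmatrix (m x) (E x) a c).
  apply: (smooth_eq Uo (smooth_map2_app Uo bm sE (cs (basis_vec K a)) c)) => x _.
  by rewrite mxE.
have s a : smooth U (fun x => \sum_c e x 0 c * invmx (mulmatrix (m x) (E x)) c a).
  apply: smooth_sum => // c _; apply: smoothM => //.
  exact: smooth_invmx.
move=> a; apply: (smooth_eq Uo (s a)) => x Ux; rewrite /F.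
by rewrite (alg_inv_unique (FA Ux) (mulmatrix_unit_inv (FA Ux) (uM x Ux))) mxE.
Qed.

Let Nsym x (Ux : U x) w u v : N x w u v = N x u w v.
Proof. exact (cov2_sym Oo sD FAO w u v symc (sub Ux)). Qed.
Let Ncomm x (Ux : U x) w u v : N x w u v = N x w v u.
Proof. exact (cov2_comm Oo FAO w u v (sub Ux)). Qed.
Let Nassoc x (Ux : U x) w u v z : N x w (m x u v) z + m x (N x w u v) z =
  N x w u (m x v z) + m x u (N x w v z).
Proof. exact (cov2_assoc Oo sD FAO w u v z (sub Ux)). Qed.
Let Nunit x (Ux : U x) w q : N x w (e x) q = 0.
Proof. exact (cov2_unit Oo sD FAO w q flat_unit (sub Ux)). Qed.
Let Neuler x (Ux : U x) u v : N x (E x) u v =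
  m x u v + T x (m x u v) - m x (T x u) v - m x u (T x v).
Proof. exact (cov2_euler Oo sD FAO u v mulE (sub Ux)). Qed.
Let Tlin x (Ux : U x) : linear (T x). Proof. exact (conn_linear bGam E Ux). Qed.
Let mZ x (Ux : U x) k q : m x (k *: e x) q = k *: q.
Proof. by rewrite (linear_funZ (frob_linl (FA Ux) q)) (frob_mul1 (FA Ux)). Qed.
(** The derivative of E F = e, where e is parallel. *)
Let dFeq x (Ux : U x) u : N x u (E x) (F x) + m x (T x u) (F x) + m x (E x) (dF x u) = 0.
Proof.
rewrite -(conn_map2_app Uo Gam u bm sE smooth_alg_inv Ux).
rewrite (@conn_eq _ _ U Uo Gam _ e x u Ux (fun y Uy => EF Uy)).
by have := flat_unit (@smooth_field_cst _ _ Om u) (sub Ux); rewrite nablaE.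
Qed.

Let BE x (Ux : U x) q : B x q = beta *: q - T x q.
Proof. by rewrite /B mZ. Qed.

Let conn_Fmul Y x u : smooth_field U Y -> U x ->
  conn Gam x u (fun y => m y (F y) (Y y)) = G x u (Y x) + m x (F x) (conn Gam x u Y).
Proof. by move=> sY Ux; rewrite (conn_map2_app Uo Gam u bm smooth_alg_inv sY Ux). Qed.

Let Glr x (Ux : U x) u : linear (Gam x u). Proof. by case: bGam => + _ _; apply. Qed.

Let bB : map_bundle U B.
Proof.
have bT := conn_map_bundle Uo bGam sE; split=> [x Ux|a].
  move=> k u v; rewrite !BE // (Tlin Ux) scalerDr !scalerBr !scalerA (mulrC beta).
  by apply/rowP => j; rewrite !mxE; ring.
have s1 := smooth_fieldD Uo (smooth_fieldZ Uo beta (cs (basis_vec K a)))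
  (smooth_fieldN Uo (smooth_map_app Uo bT (cs (basis_vec K a)))).
by apply: (smooth_field_eq Uo s1) => x Ux; rewrite BE.
Qed.

(** [B] is parallel: beta is a constant and nabla E is parallel by linearity of E, so derivatives
    pass through [B]. *)
Let conn_B Y x u : smooth_field U Y -> U x ->
  conn Gam x u (fun y => B y (Y y)) = B x (conn Gam x u Y).
Proof.
move=> sY Ux; rewrite (conn_map_app Uo Gam u bB sY Ux).
have -> : conn Gam x u (fun y => B y (Y x)) = B x (Gam x u (Y x)).
  have bT := conn_map_bundle Uo bGam sE.
  rewrite (@conn_eq _ _ U Uo Gam _ (fun y => beta *: Y x - T y (Y x)) x u Ux); last first.
    by move=> y Uy; rewrite BE.
  rewrite (connD Uo bGam u (cs _) (smooth_fieldN Uo (smooth_map_app Uo bT (cs (Y x)))) Ux).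
  rewrite conn_cst (linear_funZ (Glr Ux u)) BE //; congr (_ + _).
  have -> : (fun y => - T y (Y x)) = fun y => (-1) *: conn Gam y (Y x) E.
    by apply/funext => y; rewrite scaleN1r.
  rewrite (connZ Uo bGam (-1) u (smooth_map_app Uo bT (cs (Y x))) Ux) scaleN1r.
  by rewrite (conn_euler u (Y x) linE (sub Ux)).
by rewrite subrr add0r.
Qed.

Let smooth_Fmul Y : smooth_field U Y -> smooth_field U (fun y => m y (F y) (Y y)).
Proof. exact (smooth_map2_app Uo bm smooth_alg_inv). Qed.

Let smooth_mul Y Z : smooth_field U Y -> smooth_field U Z ->
  smooth_field U (fun y => m y (Y y) (Z y)).
Proof. exact (smooth_map2_app Uo bm). Qed.

Let bC : map2_bundle U C.
Proof.
have [Bl _] := bB; split=> [x u Ux k v w|x w Ux k u v|a c].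
- by rewrite /C (frob_linr (FA Ux) u) (frob_linr (FA Ux) (F x)) Bl.
- by rewrite /C (frob_linl (FA Ux) w) (frob_linr (FA Ux) (F x)) Bl.
exact (smooth_map_app Uo bB (smooth_Fmul (smooth_mul (cs _) (cs _)))).
Qed.

Let bGd : map2_bundle U Gd.
Proof.
have [Gr Gl sG] := bGam; have [Cr Cl sC] := bC.
split=> [x u Ux k v w|x w Ux k u v|a c].
- by rewrite /Gd Gr // Cr // (scalerDr k (Gam x u v)) addrACA.
- have El := Gl x w Ux k u v; have Ec := Cl x w Ux k u v.
  by rewrite /Gd [LHS]/= El Ec (scalerDr k (Gam x u w)) addrACA.
exact (smooth_fieldD Uo (sG a c) (sC a c)).
Qed.

Let Gd_sym x (Ux : U x) u v : Gd x u v = Gd x v u.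
Proof. by rewrite /Gd /C (Gam_sym Ux) (frob_mulC (FA Ux) u). Qed.

Let conn_Gd x u Y : conn Gd x u Y = conn Gam x u Y + C x u (Y x).
Proof. by rewrite /conn /Gd addrA. Qed.

Local Notation m' := (fmul (dual_data D)).
Local Notation g' := (fmetric (dual_data D)).

Let m'E x (Ux : U x) u v : m' x u v = m x (F x) (m x u v).
Proof. exact: (frob_mulC (FA Ux) _ (F x)). Qed.

Let g'E x (Ux : U x) u v : g' x u v = g x u (m x (F x) v).
Proof. exact (intersection_metricE (FA Ux) u v (EF Ux)). Qed.

Lemma dual_algebra x : U x -> frobenius_algebra (m' x) (E x) (g' x).
Proof. by move=> Ux; exact (dual_frobenius_algebra (FA Ux) (EF Ux)). Qed.

Lemma smooth_dual_data : smooth_data U (dual_data D).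
Proof.
split=> //.
- move=> a c k; apply: (smooth_eq Uo (smooth_Fmul
    (smooth_mul (cs (basis_vec K a)) (cs (basis_vec K c))) k)).
  by move=> x Ux; rewrite m'E.
- move=> a c; apply: (smooth_eq Uo (smooth_form2_app Uo bg
    (cs (basis_vec K a)) (smooth_Fmul (cs (basis_vec K c))))).
  by move=> x Ux; rewrite g'E.
Qed.

Let gT x (Ux : U x) u v : g x (T x u) v + g x u (T x v) = (2 - d) * g x u v.
Proof. exact (form_euler Oo sD FAO u v metE (sub Ux)). Qed.

Let glD x (Ux : U x) v := linear_funD (form_linl (FA Ux) v).
Let grD x (Ux : U x) u := linear_funD (form_linr (FA Ux) u).
Let grN x (Ux : U x) u := linear_funN (form_linr (FA Ux) u).

Let betaE : 2 - d = beta + beta + 1.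
Proof. by rewrite /beta; field. Qed.

(** By uniqueness it is enough that [Gd] is symmetric and preserves g(v, F w). The original
    connection accounts for its own share, and what remains is [dual_compat]. *)
Lemma dual_levi_civita x : U x -> levi_civita g' x = Gd x.
Proof.
move=> Ux; apply: (levi_civita_unique Uo).
- exact (fmetric_bundle smooth_dual_data dual_algebra).
- by move=> y Uy u v; apply: (form_sym (dual_algebra Uy)).
- by move=> y Uy; apply: (form_nondeg (dual_algebra Uy)).
- exact: Ux.
- exact: Gd_sym.
move=> u v w.
have -> : dd x u (fun y => g' y v w) = dd x u (fun y => g y v (m y (F y) w)).
  by apply: (dd_eq Uo) => // y Uy; rewrite g'E.
rewrite (dd_metric Uo sU FA u (cs v) (smooth_Fmul (cs w)) Ux) (conn_Fmul u (cs w) Ux).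
rewrite !conn_cst !g'E // /Gd (glD Ux) (linear_funD (frob_linr (FA Ux) (F x))).
rewrite (grD Ux v (G x u w)) (grD Ux v (m x (F x) (Gam x u w))).
have -> : g x v (G x u w) =
    g x (C x u v) (m x (F x) w) + g x v (m x (F x) (C x u w)).
  apply: (@dual_compat (frob_ring (FA Ux)) (N x) (T x) (dF x) (E x) (F x) (beta *: e x)
    (EF Ux) (Nsym Ux) (Ncomm Ux) (Nassoc Ux) (Nunit Ux) (Neuler Ux) (dFeq Ux)
    K (g x) (2 - d) beta (grD Ux) (grN Ux) (gsym Ux) (form_frob (FA Ux)) (gT Ux) _ betaE).
  by move=> p q; rewrite -[_ * q]/(m x (beta *: e x) q) mZ // (linear_funZ (form_linr (FA Ux) p)).
rewrite -/(Gam) ; ring.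
Qed.

Let dual_nabla X Y x : U x ->
  nabla g' X Y x = conn Gam x (X x) Y + C x (X x) (Y x).
Proof. by move=> Ux; rewrite nablaE /conn dual_levi_civita // /Gd addrA. Qed.

(** The dual derivative of E along X is T X + B(F X E) = T X + B X = beta X, so a second derivative
    gives beta times the connection on both sides. *)
Lemma dual_linear_field : linear_field U g' E.
Proof.
have nE X y : U y -> nabla g' X E y = beta *: X y.
  move=> Uy; rewrite dual_nabla // /C BE // -/(T y (X y)).
  rewrite (frob_mulC (FA Uy) (X y)) (frob_mulA (FA Uy)) (frob_mulC (FA Uy) (F y)) EF //.
  by rewrite (frob_mul1 (FA Uy)) addrC subrK.
move=> X Z sX sZ x Ux; rewrite [X in _ - X]nE // nablaE.
rewrite (@conn_eq _ _ U Uo _ _ (fun y => beta *: Z y) x (X x) Ux); last first.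
  by move=> y Uy; apply: nE.
have cE Y : conn (levi_civita g') x (X x) Y = conn Gd x (X x) Y.
  by rewrite /conn dual_levi_civita.
by rewrite nablaE !cE (connZ Uo bGd beta (X x) sZ Ux) subrr.
Qed.

Let Blin x (Ux : U x) : linear (B x). Proof. by case: bB => + _; apply. Qed.

Lemma dual_flat : flat_metric U g'.
Proof.
move=> X Y Z sX sY sZ x Ux; rewrite !dual_nabla //.
(* Since [B] is parallel, the derivative acts only on its argument F Y' Z. *)
have step Y' u : smooth_field U Y' -> conn Gam x u (nabla g' Y' Z) =
    conn Gam x u (fun y => conn Gam y (Y' y) Z) +
    B x (G x u (m x (Y' x) (Z x)) + m x (F x) (N x u (Y' x) (Z x) +
      m x (conn Gam x u Y') (Z x) + m x (Y' x) (conn Gam x u Z))).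
  move=> sY'; rewrite (@conn_eq _ _ U Uo Gam _ (fun y => conn Gam y (Y' y) Z +
    B y (m y (F y) (m y (Y' y) (Z y)))) x u Ux); last by move=> y Uy; apply: dual_nabla.
  have sYZ := smooth_mul sY' sZ.
  rewrite (connD Uo bGam u (smooth_conn Uo bGam sY' sZ)
    (smooth_map_app Uo bB (smooth_Fmul sYZ)) Ux).
  rewrite (conn_B u (smooth_Fmul sYZ) Ux) (conn_Fmul u sYZ Ux).
  by rewrite (conn_map2_app Uo Gam u bm sY' sZ Ux).
rewrite !step //.
have curv := curvature_eq0 Uo bGam (fun f a c sf => schwarzU a c sf Ux)
  (fun p q r => conn_flat Oo sD FAO p q r flatg (sub Ux)) sX sY sZ Ux.
have alg := @dual_curvature_eq0 (frob_ring (FA Ux)) (N x) (T x) (dF x) (E x) (F x)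
  (beta *: e x) (EF Ux) (Nsym Ux) (Ncomm Ux) (Nassoc Ux) (Nunit Ux) (Neuler Ux) (dFeq Ux)
  (X x) (Y x) (Z x).
have BD := linear_funD (Blin Ux); have BN := linear_funN (Blin Ux).
(* By linearity of [B], the dual curvature splits into the original curvature and [B] of a single
   vector. *)
have combine (c1 c2 c3 t1 t2 t3 t4 t5 : V) : c1 - c2 - c3 = 0 ->
    t1 + t2 - t3 - t4 - t5 = 0 ->
    c1 + B x t1 + B x t2 - (c2 + B x t3 + B x t4) - (c3 + B x t5) = 0.
  move=> c0 t0; have : B x (t1 + t2 - t3 - t4 - t5) = 0.
    by rewrite t0; apply: linear_fun0 (Blin Ux).
  rewrite !BD !BN => b0.
  transitivity ((c1 - c2 - c3) + (B x t1 + B x t2 - B x t3 - B x t4 - B x t5)).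
    by move: (B x) => b; apply/rowP => k; rewrite !mxE; ring.
  by rewrite c0 b0 addr0.
apply: combine; first exact: curv.
(* The bracket absorbs the derivatives of X and Y by absence of torsion, and symmetry of [N] removes
   the derivative of the product; only [dual_curvature_eq0] is left. *)
rewrite (bracket_conn Gam_sym) // (Nsym Ux (Y x)).
have ringA (f g1 g2 n0 py pz qx qz c1 c2 p q r : frob_ring (FA Ux)) :
    g1 - g2 + f * (p * c1) - f * (q * c2) = 0 ->
    g1 + f * (n0 + py * r + q * pz) + f * (p * (qz + c1)) -
    (g2 + f * (n0 + qx * r + p * qz)) - f * (q * (pz + c2)) - f * ((py - qx) * r) = 0.
  by move=> <-; ring.
exact: ringA alg.
Qed.

Let conn_mul_cst x w u v : U x -> conn Gam x w (fun y => m y u v) =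
  N x w u v + m x (Gam x w u) v + m x u (Gam x w v).
Proof. by move=> Ux; rewrite (conn_map2_app Uo Gam w bm (cs u) (cs v) Ux) !conn_cst. Qed.

Lemma dual_nabla_c : nabla_c_symmetric U m' g'.
Proof.
apply: (nabla_c_symmetric_cov2 Uo smooth_dual_data dual_algebra) => x w u v Ux.
(* The Christoffel terms of the original connection cancel, leaving the two sides of
   [dual_product_sym]. *)
have cov2E p q r : cov2 (levi_civita g') m' x p q r =
    G x p (m x q r) + m x (F x) (N x p q r) + C x p (m x (F x) (m x q r))
    - m x (F x) (m x (C x p q) r) - m x (F x) (m x q (C x p r)).
  rewrite /cov2 /conn dual_levi_civita // -/(conn Gd x p _) conn_Gd !m'E //.
  rewrite (@conn_eq _ _ U Uo Gam _ (fun y => m y (F y) (m y q r)) x p Ux); last first.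
    by move=> y Uy; rewrite m'E.
  rewrite (conn_Fmul p (smooth_mul (cs q) (cs r)) Ux) conn_mul_cst //.
  have ringA (f g0 n0 c0 a1 c1 a2 c2 q0 r0 : frob_ring (FA Ux)) :
    g0 + f * (n0 + a1 * r0 + q0 * a2) + c0 - f * ((a1 + c1) * r0) - f * (q0 * (a2 + c2))
    = g0 + f * n0 + c0 - f * (c1 * r0) - f * (q0 * c2) by ring.
  exact: ringA.
rewrite !cov2E.
exact: (@dual_product_sym (frob_ring (FA Ux)) (N x) (T x) (dF x) (E x) (F x)
  (beta *: e x) (EF Ux) (Nsym Ux) (Ncomm Ux) (Nassoc Ux) (Nunit Ux) (Neuler Ux) (dFeq Ux)
  w u v).
Qed.

Lemma dual_euler_mul_field : euler_mul U m' E 0.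
Proof.
move=> X Y sX sY x Ux; rewrite scale0r /mulf !(bracket_conn Gam_sym) // !m'E //.
have sXY := smooth_mul sX sY.
rewrite (@conn_eq _ _ U Uo Gam _ (fun y => m y (F y) (m y (X y) (Y y))) x (E x) Ux); last first.
  by move=> y Uy; rewrite m'E.
rewrite (conn_Fmul (E x) sXY Ux) (conn_map2_app Uo Gam (E x) bm sX sY Ux).
have alg := @dual_euler_mul (frob_ring (FA Ux)) (N x) (T x) (dF x) (E x) (F x)
  (EF Ux) (Nsym Ux) (Ncomm Ux) (Nassoc Ux) (Nunit Ux) (Neuler Ux) (dFeq Ux) (X x) (Y x).
have ringA (f g0 n0 a b tx ty tf p q : frob_ring (FA Ux)) :
    g0 + f * n0 - tf + f * (tx * q) + f * (p * ty) = 0 ->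
    g0 + f * (n0 + a * q + p * b) - tf - f * ((a - tx) * q) - f * (p * (b - ty)) = 0.
  by move=> <-; ring.
exact: ringA alg.
Qed.

(** The charge 1 + d is the one for which 2 - (1 + d) equals the weight (2 - d) - 1 found
    pointwise. *)
Lemma dual_euler_metric : euler_metric U g' E (1 + d).
Proof.
move=> X Y sX sY x Ux; rewrite /metf !(bracket_conn Gam_sym) // !g'E //.
have -> : vf_apply E (fun y => g' y (X y) (Y y)) x =
    dd x (E x) (fun y => g y (X y) (m y (F y) (Y y))).
  by apply: (dd_eq Uo) => // y Uy; rewrite g'E.
rewrite (dd_metric Uo sU FA (E x) sX (smooth_Fmul sY) Ux) (conn_Fmul (E x) sY Ux).
have alg := @dual_euler_form (frob_ring (FA Ux)) (N x) (T x) (dF x) (E x) (F x)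
  (EF Ux) (Nsym Ux) (Ncomm Ux) (Nassoc Ux) (Nunit Ux) (Neuler Ux) (dFeq Ux)
  K (g x) (2 - d) (grD Ux) (grN Ux) (gT Ux) (X x) (Y x).
have -> : (2 - (1 + d)) * g x (X x) (m x (F x) (Y x)) =
  g x (X x) (G x (E x) (Y x)) + g x (T x (X x)) (m x (F x) (Y x))
   + g x (X x) (m x (F x) (T x (Y x))).
  by rewrite [RHS]alg; congr (_ * _); ring.
have mD := linear_funD (frob_linr (FA Ux) (F x)); have mN := linear_funN (frob_linr (FA Ux) (F x)).
move: (conn Gam x (E x) X) (conn Gam x (E x) Y) => a b.
rewrite (mD b) mN (glD Ux _ a) (linear_funN (form_linl (FA Ux) _)) (grD Ux _ (G x _ _)).
rewrite (grD Ux _ (m x (F x) b)) (grN Ux) -/(T x (X x)) -/(T x (Y x)); ring.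
Qed.

Lemma dual_local_frobenius : local_frobenius U 0 (1 + d) (dual_data D).
Proof.
split; [exact: smooth_dual_data|exact: dual_algebra|exact: dual_flat|exact: dual_nabla_c|].
by split; [exact: dual_linear_field|exact: dual_euler_mul_field|exact: dual_euler_metric].
Qed.

End DualStructure.

(** * Globalization *)

Section ChartDomains.
Variables (K : numFieldType) (n : nat) (M : topologicalType) (A : manifold K n M).

(** Near an image point every vector is the image of a point of the chart, and continuity of the
    inverse chart keeps that point in [W]. *)
Lemma chart_image_open_sub (W : set M) (i : chart_index A) :
  open W -> open (chart_image W i).
Proof.
move=> Wo; rewrite openE => _ [t [it Wt] <-].
have nO : nbhs (chart i t) (chart i @` chart_dom i).
  by apply: open_nbhs_nbhs; split; [apply: chart_image_open|exists t].
have nW : nbhs (chart i t) (fun y => W (chart_inv i y)).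
  apply: (chart_inv_continuous it); rewrite chartK //.
  exact: open_nbhs_nbhs.
rewrite /interior; apply: (filterS _ (filterI nO nW)) => _ [[s si <-]].
by rewrite chartK // => Ws; exists s.
Qed.

End ChartDomains.

(** * The complement of the discriminant and changes of charts *)

Section AlmostDual.
Variables (K : numFieldType) (n : nat) (M : topologicalType) (A : manifold K n M).
Variables (D : chart_index A -> frob_data K n) (d : K).
Hypothesis tensD : tensorial setT D.
Hypothesis localD : forall i, local_frobenius (chart_image setT i) 1 d (D i).
Implicit Types (i j : chart_index A) (t : M).
Local Notation m i t := (fmul (D i) (chart i t)).
Local Notation g i t := (fmetric (D i) (chart i t)).
Local Notation e i t := (funit (D i) (chart i t)).
Local Notation E i t := (feuler (D i) (chart i t)).

Let dom_image i t : chart_dom i t -> chart_image setT i (chart i t).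
Proof. by move=> it; exists t. Qed.

Let FA i t (it : chart_dom i t) : frobenius_algebra (m i t) (e i t) (g i t).
Proof. by have [_ + _ _ _] := localD i; apply; apply: dom_image. Qed.

Lemma euler_invertible i t : chart_dom i t -> (~` discriminant D) t ->
  exists f, m i t (E i t) f = e i t.
Proof.
move=> it Wt; apply: (nondeg_invertible (FA it)).
by apply: contrapT => nd; apply: Wt; exists i.
Qed.

Lemma chart_inverse i j t f : chart_dom i t -> chart_dom j t ->
  m i t (E i t) f = e i t -> m j t (E j t) (f *m jacobian i j t) = e j t.
Proof.
move=> it jt Ef; have [mJ _ eJ EJ] := tensD I it jt.
by rewrite EJ mJ Ef eJ.
Qed.

(** Off the discriminant the determinant of multiplication by E, a continuous function in a chart,
    is nonzero; this persists nearby and makes E invertible there. *)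
Lemma discriminantC_open : open (~` discriminant D).
Proof.
rewrite openE => t Wt; have [i it] := chart_cover A t.
have [[sD FAi _ _ _] Oo] := (localD i, @chart_image_open_sub _ _ _ A setT i openT).
pose delta x := \det (mulmatrix (fmul (D i) x) (feuler (D i) x)).
have sdelta : smooth (chart_image setT i) delta.
  have [_ _ _ sE] := sD; apply: (smooth_det Oo) => a c.
  have bm := fmul_bundle sD FAi.
  have ca := @smooth_field_cst _ _ (chart_image setT i) (basis_vec K a).
  by apply: (smooth_eq Oo (smooth_map2_app Oo bm sE ca c)) => x _; rewrite mxE.
have delta0 : delta (chart i t) != 0.
  have [f Ef] := euler_invertible it Wt.
  by have := mulmatrix_inv (FA it) Ef; rewrite unitmxE unitfE.
have cdelta : delta x @[x --> chart i t] --> delta (chart i t).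
  exact: smooth_continuous sdelta (dom_image it).
have ndelta : nbhs (chart i t) (fun x => delta x != 0).
  exact: (@cvgr_neq0 _ _ _ (nbhs (chart i t)) _ _ _ cdelta delta0).
have nt : nbhs t (fun s => delta (chart i s) != 0).
  exact: chart_continuous it _ ndelta.
have nd : nbhs t (chart_dom i) by apply: open_nbhs_nbhs; split => //; apply: chart_dom_open.
(* Degeneracy at [s] may be witnessed in another chart [j], so the inverse found in chart [i] is
   carried there by the Jacobian. *)
rewrite /interior; apply: (filterS _ (filterI nd nt)) => s [si ds] [j js]; apply.
have us : mulmatrix (m i s) (E i s) \in unitmx by rewrite unitmxE unitfE.
have Es := mulmatrix_unit_inv (FA si) us.
exact: (intersection_nondeg (FA js) (chart_inverse si js Es)).
Qed.

(** The inverse of E transforms by the Jacobian, so the dual product and metric, written through it,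
    inherit the transformation rules of the original ones. *)
Lemma almost_dual_tensorial : tensorial (~` discriminant D) (almost_dual D).
Proof.
move=> i j t Wt it jt J x y; have [mJ gJ _ EJ] := tensD I it jt.
have [f Ef] := euler_invertible it Wt.
have EfJ := chart_inverse it jt Ef.
split=> // [u v|u v].
  rewrite /= /alg_div (alg_inv_unique (FA it) Ef) (alg_inv_unique (FA jt) EfJ).
  by rewrite !mJ.
rewrite /= (intersection_metricE (FA it) _ _ Ef) (intersection_metricE (FA jt) _ _ EfJ).
by rewrite !mJ gJ.
Qed.

End AlmostDual.

Theorem proposition1 (R : realType) (g : ground) (n : nat)
    (M : topologicalType) (A : manifold (scalars R g) n M)
    (D : chart_index A -> frob_data (scalars R g) n) :
  frobenius_manifold D ->
  frobenius_except_flat_unity (~` discriminant D) 0 (almost_dual D).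
Proof.
move=> [[_ tensD [d localD]] flat_unit].
have Wo := discriminantC_open tensD localD.
split; [exact: Wo|exact: almost_dual_tensorial tensD localD|exists (1 + d) => i].
have Uo := @chart_image_open_sub _ _ _ A _ i Wo.
have Oo := @chart_image_open_sub _ _ _ A _ i openT.
(* What remains is the inclusion of the chart images, the symmetry of mixed derivatives over the
   ground field, and invertibility of E off the discriminant. *)
apply: (dual_local_frobenius Oo Uo _ (localD i) (flat_unit i)).
- by move=> _ [t [it _] <-]; exists t.
- by move=> f x a c sf Ux; apply: pd_comm Uo sf Ux.
- by move=> _ [t [it Wt] <-]; apply: (euler_invertible localD it Wt).
Qed.
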